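(* Under the standing assumptions stated in the context, the following hold. (i) Strong duality holds: $\mathscr{P}=\mathscr{D}$. (ii) The primal problem $\mathscr{P}=\inf_{Z\in\mathcal{Z}}\int cZ\,dP+\frac12\|Z\|_{L^2(P)}^2$ has a unique solution $Z_*\in\mathcal{Z}$, given by the $L^2(P)$-projection $Z_*=\arg\min_{Z\in\mathcal{Z}}\|Z+c\|_{L^2(P)}^2$ of $-c$ onto $\mathcal{Z}$. In particular, $Z_*$ is characterized (within $\mathcal Z$) by $$\langle Z_*+c,\,Z-Z_*\rangle_{L^2(P)}\ge 0\quad\text{for all } Z\in\mathcal{Z}.$$ The coupling $\pi_*\in\Pi(\mu,\nu)$ given by $d\pi_*=Z_*\,dP$ is the unique solution of the regularized transport problem $\inf_{\pi\in\Pi(\mu,\nu)}\int c\,d\pi+\frac12\left\|\frac{d\pi}{dP}\right\|_{L^2(P)}^2$. (iii) There exist measurable functions $f:X\to\mathbb{R}$ and $g:Y\to\mathbb{R}$ satisfying the following conditions (a)–(d), and for measurable $f:X\to\mathbb{R}$, $g:Y\to\mathbb{R}$ these conditions are equivalent: (a) $(f\oplus g-c)_+$ is the density $Z_*\in\mathcal{Z}$ of the optimal coupling $\pi_*$ (with respect to $P$); (b) $(f\oplus g-c)_+$ is the $P$-density of some coupling $\pi\in\Pi(\mu,\nu)$; (c) $(f,g)\in L^1(\mu)\times L^1(\nu)$ and $(f,g)$ is a solution of the dual problem, i.e. attains the supremum defining $\mathscr{D}$; (d) $(f,g)$ satisfies the system $$\int_X (f(x)+g(y)-c(x,y))_+\,\tilde\mu(dx)=\frac{d\nu}{d\tilde\nu}(y)\quad\text{for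 }\tilde\nu\text{-a.e. }y\in Y,$$ $$\int_Y (f(x)+g(y)-c(x,y))_+\,\tilde\nu(dy)=\frac{d\mu}{d\tilde\mu}(x)\quad\text{for }\tilde\mu\text{-a.e. }x\in X.$$ Any such $(f,g)$ (called potentials) necessarily belongs to $L^1(\mu)\times L^1(\nu)$. (iv) Suppose that $(X,\mu,\tilde\mu)=(Y,\nu,\tilde\nu)$ and $c(x,y)=c(y,x)$. Then the existence in (iii) also holds with the additional requirement that $f=g$, and the dual problem has the same value $\mathscr{D}$ if the supremum is restricted to pairs with $f=g$.
   Context: Standing assumptions and notation. $(X,\mathcal{B}(X),\mu)$ and $(Y,\mathcal{B}(Y),\nu)$ are Polish probability spaces; $X\times Y$ carries the product $\sigma$-field. $\Pi(\mu,\nu)$ is the set of couplings of $(\mu,\nu)$, i.e. measures on $X\times Y$ with first marginal $\mu$ and second marginal $\nu$. For $f:X\to\mathbb{R}$, $g:Y\to\mathbb{R}$, $(f\oplus g)(x,y):=f(x)+g(y)$; $a_+=\max(a,0)$. $\tilde\mu$ and $\tilde\nu$ are probability measures on $X$ and $Y$ with $\mu\sim\tilde\mu$, $\nu\sim\tilde\nu$ (mutual absolute continuity) and $$\frac{d\mu}{d\tilde\mu}\in L^2(\tilde\mu),\quad \Big(\frac{d\mu}{d\tilde\mu}\Big)^{-1}\in L^\infty(\tilde\mu),\quad \frac{d\nu}{d\tilde\nu}\in L^2(\tilde\nu),\quad \Big(\frac{d\nu}{d\tilde\nu}\Big)^{-1}\in L^\infty(\tilde\nu).$$ The reference measure is $P:=\tilde\mu\otimes\tilde\nu$.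 The cost $c:X\times Y\to\mathbb{R}$ satisfies $c\in L^2(P)$ and $c\ge c_1\oplus c_2$ for some $c_1\in L^1(\mu)\cap L^1(\tilde\mu)$ and $c_2\in L^1(\nu)\cap L^1(\tilde\nu)$. The regularized transport problem is $\inf_{\pi\in\Pi(\mu,\nu)}\int c\,d\pi+\frac12\|d\pi/dP\|_{L^2(P)}^2$, where by convention any coupling $\pi\not\ll P$ has infinite cost. Set $\mathcal{Z}:=\{Z\in L^2(P): Z\,dP\in\Pi(\mu,\nu)\}$. The primal problem is $$\mathscr{P}:=\inf_{Z\in\mathcal{Z}}\int cZ\,dP+\tfrac12\|Z\|_{L^2(P)}^2,$$ and the dual problem is $$\mathscr{D}:=\sup_{f\in L^1(\mu),\,g\in L^1(\nu)}\int f\,d\mu+\int g\,d\nu-\tfrac12\int (f\oplus g-c)_+^2\,dP.$$ *)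

(* Defs.v *)
From HB Require Import structures.
From mathcomp Require Import all_boot all_order all_algebra.
From mathcomp Require Import all_classical all_reals all_analysis.

Set Implicit Arguments.
Unset Strict Implicit.
Unset Printing Implicit Defensive.

Import Order.TTheory GRing.Theory Num.Theory.
Import numFieldNormedType.Exports.

Local Open Scope classical_set_scope.
Local Open Scope ring_scope.
Local Open Scope ereal_scope.
Local Open Scope charge_scope.

(* Separable and homeomorphic to a complete metric space; completeness is the
   axiom of [completeType], for the uniform structure of the metric of [M]. *)
Definition polish (R : realType) (T : topologicalType) : Prop :=
  (exists2 D : set T, countable D & dense D) /\
  exists (M : metricType R) (h : T -> M) (k : M -> T),
    [/\ cancel h k, cancel k h, continuous h, continuous k
      & forall F : set_system M, ProperFilter F -> cauchy F ->
          exists x : M, F --> x].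

Notation borel T := (g_sigma_algebraType (@open T)).

Definition argmin (R : realType) (T : Type) (A : set T) (F : T -> \bar R)
    (x : T) : Prop :=
  A x /\ forall y, A y -> F x <= F y.

(* Real-valued representative of the Radon-Nikodym derivative: ['d mu '/d nu]
   is everywhere finite when [mu `<< nu]. *)
Definition density (R : realType) d (T : measurableType d)
    (mu nu : probability T R) (x : T) : R :=
  fine (('d (charge_of_finite_measure mu) '/d nu) x).

(* [(f (+) g - c)_+] *)
Definition pospart (R : realType) (T1 T2 : Type) (f : T1 -> R) (g : T2 -> R)
    (c : T1 * T2 -> R) (z : T1 * T2) : R :=
  Num.max (f z.1 + g z.2 - c z)%R 0%R.

Section quadratic_ot.
Context (R : realType) d1 d2 (X : measurableType d1) (Y : measurableType d2).
Implicit Types (mu tmu : probability X R) (nu tnu : probability Y R).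
Implicit Types (c Z : X * Y -> R) (f : X -> R) (g : Y -> R).
Implicit Types (pi : probability (X * Y)%type R).

(* The reference measure [P]; the cast to [probability] lets [P] be used where
   a sigma-finite measure is expected. *)
Definition refm tmu tnu : probability (X * Y)%type R := tmu \x tnu.

(* In the conditions on the inverse densities, the convention [0^-1 = 0] is
   harmless: the densities vanish on null sets only, by equivalence of the
   measures. *)
Record standing_assumptions mu nu tmu tnu c : Prop := {
  equiv_mu : mu `<< tmu /\ tmu `<< mu ;
  equiv_nu : nu `<< tnu /\ tnu `<< nu ;
  density_mu_L2 : density mu tmu \in Lfun tmu 2%:E ;
  density_mu_inv_Loo : (fun x => (density mu tmu x)^-1)%R \in Lfun tmu +oo ;
  density_nu_L2 : density nu tnu \in Lfun tnu 2%:E ;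
  density_nu_inv_Loo : (fun y => (density nu tnu y)^-1)%R \in Lfun tnu +oo ;
  cost_L2 : c \in Lfun (refm tmu tnu) 2%:E ;
  cost_lower_bound : exists (c1 : X -> R) (c2 : Y -> R),
    [/\ c1 \in Lfun mu 1, c1 \in Lfun tmu 1,
        c2 \in Lfun nu 1, c2 \in Lfun tnu 1
      & forall x y, (c1 x + c2 y <= c (x, y))%R]
}.

Definition coupling mu nu : set (probability (X * Y)%type R) :=
  [set pi | (forall A, measurable A -> pi (fst @^-1` A) = mu A) /\
            (forall B, measurable B -> pi (snd @^-1` B) = nu B)].

(* [d pi = Z dP] with [P = refm tmu tnu] *)
Definition has_density tmu tnu pi Z : Prop :=
  forall A, measurable A -> pi A = \int[refm tmu tnu]_(z in A) (Z z)%:E.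

Definition admissible mu nu tmu tnu : set (X * Y -> R) :=
  [set Z | Z \in Lfun (refm tmu tnu) 2%:E /\
           exists2 pi, coupling mu nu pi & has_density tmu tnu pi Z].

Definition sqnorm tmu tnu (F : X * Y -> \bar R) : \bar R :=
  'N[refm tmu tnu]_2%:E[F] ^+ 2.

Definition primal_cost tmu tnu c Z : \bar R :=
  \int[refm tmu tnu]_z (c z * Z z)%:E
  + (2^-1)%:E * sqnorm tmu tnu (EFin \o Z).

Definition primal_value mu nu tmu tnu c : \bar R :=
  ereal_inf (primal_cost tmu tnu c @` admissible mu nu tmu tnu).

Definition dual_objective mu nu tmu tnu c f g : \bar R :=
  \int[mu]_x (f x)%:E + \int[nu]_y (g y)%:E
  - (2^-1)%:E * \int[refm tmu tnu]_z (pospart f g c z ^+ 2)%:E.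

Definition dual_value mu nu tmu tnu c : \bar R :=
  ereal_sup [set dual_objective mu nu tmu tnu c fg.1 fg.2 |
    fg in [set fg : (X -> R) * (Y -> R) |
            fg.1 \in Lfun mu 1 /\ fg.2 \in Lfun nu 1]].

Definition regularized_cost tmu tnu c pi : \bar R :=
  if `[< pi `<< (refm tmu tnu) >] then
    \int[pi]_z (c z)%:E
    + (2^-1)%:E * sqnorm tmu tnu
        ('d (charge_of_finite_measure pi) '/d (refm tmu tnu))
  else +oo.

Definition inner tmu tnu Z Z' : R :=
  (\int[refm tmu tnu]_z (Z z * Z' z))%R.

(* The four equivalent conditions on a pair of potentials; in the first one,
   [Zs] is the density of the optimal coupling. *)
Definition optimal_density tmu tnu c Zs f g : Prop :=
  pospart f g c = Zs %[ae (refm tmu tnu)].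

Definition coupling_density mu nu tmu tnu c f g : Prop :=
  exists2 pi, coupling mu nu pi & has_density tmu tnu pi (pospart f g c).

Definition dual_solution mu nu tmu tnu c f g : Prop :=
  [/\ f \in Lfun mu 1, g \in Lfun nu 1
    & dual_objective mu nu tmu tnu c f g = dual_value mu nu tmu tnu c].

Definition potential_system mu nu tmu tnu c f g : Prop :=
  (\forall y \ae tnu,
      \int[tmu]_x (pospart f g c (x, y))%:E = (density nu tnu y)%:E) /\
  (\forall x \ae tmu,
      \int[tnu]_y (pospart f g c (x, y))%:E = (density mu tmu x)%:E).

End quadratic_ot.

(* Main.v *)
Require Import Defs.
From HB Require Import structures.
From mathcomp Require Import all_boot all_order all_algebra.
From mathcomp Require Import all_classical all_reals all_analysis.
From mathcomp Require Import measurable_realfun ess_sup_inf.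
From mathcomp Require Import ring lra.

Set Implicit Arguments.
Unset Strict Implicit.
Unset Printing Implicit Defensive.

Import Order.TTheory GRing.Theory Num.Theory.
Import numFieldNormedType.Exports.

Local Open Scope classical_set_scope.
Local Open Scope ring_scope.
Local Open Scope ereal_scope.

(** Write [P] for the reference measure, [h = f (+) g - c], [p = h_+], and let
    [Z] be the [P]-density of a coupling. Since [f (+) g] integrates against
    [Z dP] to [int f dmu + int g dnu], the value of the primal problem at [Z]
    minus the value of the dual problem at [(f, g)] is the integral of
    [Z^2 / 2 + p^2 / 2 - h Z], an integrand that is at least [(Z - p)^2 / 2] and
    vanishes when [Z = p] (lemmas [gap_Rint], [duality_gap] and [gap_eq]).

    Suppose therefore that some pair [(f, g)] makes [p] the density of a
    coupling. Then the primal value at any [Z] exceeds the one at [p] by at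
    least half the squared distance of [Z] to [p] ([primal_growth]), the pair is
    dual optimal, and the two values agree. Strong duality, uniqueness, the
    variational inequality, the description as a projection (the squared
    distance of [Z] to [- c] is an affine function of the primal value) and the
    equivalence of the four conditions all follow from this inequality. Three
    points remain.

    Existence ([dual_attained], [maximiser_coupling]). The duality gap relative
    to the independent coupling bounds [f (+) g] in [L^1(mu x nu)] along a
    maximising sequence. The superlevel sets of the concave dual functional are
    convex, so that the sequence can be chosen almost everywhere convergent
    ([convex_ae_cvg]); a limit of sums [f_k (+) g_k] is again such a sum
    ([ae_cvg_split]), and it is a maximiser by Fatou's lemma applied to the
    gap. The first-order condition at a maximiser says that [p] has the right
    marginals.

    Integrability of potentials ([potentials_dual_pair]). The first marginal of
    [p] being the square integrable density of [mu], [f] is integrable from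
    above; that density being bounded away from 0 and [c] being bounded below by
    [c1 (+) c2], [f] is bounded below by [c1] minus a constant.

    Symmetric case ([symmetric_potential]). If [(f, g)] is optimal, so is
    [(g, f)], and by concavity so is their average. *)

Local Notation intg m f := (integrable m [set: _] (EFin \o f)).

Ltac meas :=
  repeat first
  [ assumption
  | match goal with H : forall k, measurable_fun _ _ |- _ => exact: (H _) end
  | exact: measurable_cst | exact: measurable_id
  | apply: measurable_funD | apply: measurable_funB | apply: measurable_funM
  | apply: measurable_funX | apply: measurable_maxr | apply: measurable_funN
  | apply: (measurableT_comp (@normr_measurable _ _))
  | exact/measurable_EFinP
  | match goal with
    | H : measurable_fun _ ?f |- measurable_fun _ (fun z => ?f (fst z)) =>
        exact: (measurableT_comp H measurable_fst)
    | H : measurable_fun _ ?f |- measurable_fun _ (fun z => ?f (snd z)) =>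
        exact: (measurableT_comp H measurable_snd)
    end ].

(** * Integrable real functions *)

Section integrable_real.
Context d (T : measurableType d) (R : realType) (m : {measure set T -> \bar R}).
Implicit Types f g : T -> R.

Lemma intg_meas f : intg m f -> measurable_fun setT f.
Proof. by move=> /measurable_int/measurable_EFinP. Qed.

Lemma intgD f g : intg m f -> intg m g -> intg m (fun x => f x + g x)%R.
Proof. by move=> mf mg; exact: (integrableD measurableT mf mg). Qed.

Lemma intgB f g : intg m f -> intg m g -> intg m (fun x => f x - g x)%R.
Proof. by move=> mf mg; exact: (integrableB measurableT mf mg). Qed.

Lemma intgZ (r : R) f : intg m f -> intg m (fun x => r * f x)%R.
Proof. by move=> mf; exact: (integrableZl measurableT r mf). Qed.

Lemma intg_abs f : intg m f -> intg m (fun x => `|f x|)%R.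
Proof. by move=> mf; exact: integrable_norm. Qed.

Lemma intg_le f g : measurable_fun setT f -> intg m g ->
  (forall x, `|f x| <= g x)%R -> intg m f.
Proof.
move=> mf ig fg; apply: (le_integrable measurableT _ _ ig).
  exact/measurable_EFinP.
by move=> x _ /=; rewrite lee_fin (le_trans (fg x))// ler_norm.
Qed.

Lemma ae_intg f g : measurable_fun setT g -> f = g %[ae m] ->
  intg m f -> intg m g.
Proof.
move=> mg fg /integrableP[mf foo]; apply/integrableP; split.
  exact/measurable_EFinP.
rewrite (le_lt_trans _ foo)// le_eqVlt; apply/orP; left; apply/eqP.
apply: ae_eq_integral => //.
- by apply: measurableT_comp => //; exact/measurable_EFinP.
- exact: measurableT_comp.
- by apply: filterS fg => x /= + _ => ->.
Qed.

Lemma intg_lty f : measurable_fun setT f -> (forall x, 0 <= f x)%R ->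
  \int[m]_x (f x)%:E < +oo -> intg m f.
Proof.
move=> mf f0 foo; apply/integrableP; split; first exact/measurable_EFinP.
by under eq_integral => x _ do rewrite /= ger0_norm//.
Qed.

Lemma EFin_Rint f : intg m f -> ((\int[m]_x f x)%R)%:E = \int[m]_x (f x)%:E.
Proof. by move=> /(integrable_fin_num measurableT) fi;
  rewrite /Rintegral fineK. Qed.

Lemma ae_Rint f g : measurable_fun setT f -> measurable_fun setT g ->
  f = g %[ae m] -> (\int[m]_x f x = \int[m]_x g x)%R.
Proof.
move=> mf mg fg; congr fine; apply: ae_eq_integral => //.
- exact/measurable_EFinP.
- exact/measurable_EFinP.
- by apply: filterS fg => x /= + _ => ->.
Qed.

Lemma ae_ge0_Rint f : measurable_fun setT f -> (\forall x \ae m,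
  (0 <= f x)%R) ->
  (0 <= \int[m]_x f x)%R.
Proof.
move=> mf f0; rewrite (@ae_Rint _ (fun x => `|f x|)%R)//.
- exact: Rintegral_ge0.
- by meas.
- by apply: filterS f0 => x fx _; rewrite ger0_norm.
Qed.

Lemma ae_le_Rint f g : intg m f -> intg m g ->
  (\forall x \ae m, (f x <= g x)%R) -> (\int[m]_x f x <= \int[m]_x g x)%R.
Proof.
move=> mf mg fg; rewrite -subr_ge0 -RintegralB//; apply: ae_ge0_Rint.
  by apply: measurable_funB; exact: intg_meas.
by apply: filterS fg => x; rewrite subr_ge0.
Qed.

Lemma ge0_Rint_eq0 f : intg m f -> (forall x, 0 <= f x)%R ->
  (\int[m]_x f x = 0)%R -> f = cst 0%R %[ae m].
Proof.
move=> fi f0 i0; have : \int[m]_x `|(EFin \o f) x| = 0.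
  under eq_integral => x _ do rewrite /= ger0_norm//.
  by rewrite -EFin_Rint// i0.
move/(ae_eq_integral_abs m measurableT (measurable_int _ fi)).
by apply: filterS => x /(_ I)[] + _.
Qed.

Lemma L2P f : f \in Lfun m 2%:E <->
  measurable_fun setT f /\ intg m (fun x => f x ^+ 2)%R.
Proof.
split=> [f2|[mf fi]].
  split; last exact: Lfun2_integrable_sqr.
  by move: f2; rewrite inE => /andP[/[!inE]].
rewrite inE; apply/andP; split; rewrite inE//=.
rewrite /finite_norm unlock poweR_lty//.
rewrite (le_lt_trans _ (integrable_lty measurableT fi))//.
rewrite le_eqVlt; apply/orP; left; apply/eqP; apply: eq_integral => x _ /=.
by rewrite powR_mulrn// real_normK// num_real.
Qed.

Lemma L1P f : f \in Lfun m 1 <-> intg m f.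
Proof. exact: Lfun1_integrable. Qed.

End integrable_real.

Section finite_integrable.
Context d (T : measurableType d) (R : realType) (m : probability T R).
Implicit Types f g : T -> R.

Lemma intg_cst (r : R) : intg m (fun=> r).
Proof. exact: finite_measure_integrable_cst. Qed.

Lemma Rint_cst (r : R) : (\int[m]_x r = r)%R.
Proof.
by rewrite Rintegral_cst// -[RHS]mulr1; congr (_ * _)%R;
  exact: (congr1 fine (@probability_setT _ _ _ m)).
Qed.

Lemma sq_intgM f g : measurable_fun setT f -> measurable_fun setT g ->
  intg m (fun x => f x ^+ 2)%R -> intg m (fun x => g x ^+ 2)%R ->
  intg m (fun x => f x * g x)%R.
Proof.
move=> mf mg fi gi; apply: (intg_le (g := fun x => (f x ^+ 2 + g x ^+ 2)%R)).
- by meas.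
- exact: intgD.
- move=> x; rewrite ler_norml; apply/andP; split; nra.
Qed.

Lemma sq_intg f : measurable_fun setT f ->
  intg m (fun x => f x ^+ 2)%R -> intg m f.
Proof.
move=> mf fi; apply: (intg_le (g := fun x => (f x ^+ 2 + 1)%R)) => //.
  by apply: intgD => //; exact: intg_cst.
move=> x; rewrite ler_norml; apply/andP; split; nra.
Qed.

Lemma sq_intgD f g : measurable_fun setT f -> measurable_fun setT g ->
  intg m (fun x => f x ^+ 2)%R -> intg m (fun x => g x ^+ 2)%R ->
  intg m (fun x => (f x + g x) ^+ 2)%R.
Proof.
move=> mf mg fi gi.
apply: (intg_le (g := fun x => (2 * (f x ^+ 2) + 2 * (g x ^+ 2))%R)).
- by meas.
- by apply: intgD; exact: intgZ.
- move=> x; rewrite ger0_norm ?sqr_ge0// -subr_ge0.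
  rewrite [leRHS](_ : _ = (f x - g x) ^+ 2)%R ?sqr_ge0//; ring.
Qed.

Lemma sq_intgB f g : measurable_fun setT f -> measurable_fun setT g ->
  intg m (fun x => f x ^+ 2)%R -> intg m (fun x => g x ^+ 2)%R ->
  intg m (fun x => (f x - g x) ^+ 2)%R.
Proof.
move=> mf mg fi gi; apply: (@sq_intgD _ (fun x => - g x)%R) => //.
  exact: measurable_funN.
by under eq_fun do rewrite sqrrN.
Qed.

End finite_integrable.

Section sqnorm.
Context (R : realType) d1 d2 (X : measurableType d1) (Y : measurableType d2).
Variables (tmu : probability X R) (tnu : probability Y R).
Notation P := (refm tmu tnu).

Lemma sqnormE (F : X * Y -> R) :
  sqnorm tmu tnu (EFin \o F) = \int[P]_z (F z ^+ 2)%:E.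
Proof.
rewrite /sqnorm.
have N2 : 'N[P]_2%:E[EFin \o F] `^ 2 = \int[P]_z (F z ^+ 2)%:E.
  rewrite poweR_Lnorm ?pnatr_eq0//; apply: eq_integral => z _ /=.
  by rewrite powR_mulrn// real_normK// num_real.
rewrite -N2.
have := Lnorm_ge0 P 2%:E (EFin \o F).
case: ('N[P]_2%:E[EFin \o F]) => [r|_|//].
- by rewrite lee_fin => r0; rewrite poweR_EFin powR_mulrn// expe2 -EFinM.
- by rewrite expe2 mulyy poweRyr// pnatr_eq0.
Qed.

End sqnorm.

(** * Densities and image measures *)

Lemma null_dominates_ae d (T : measurableType d) (R : realType)
    (m r : {measure set T -> \bar R}) (Q : T -> Prop) :
  m `<< r -> (\forall x \ae r, Q x) -> \forall x \ae m, Q x.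
Proof.
move=> /null_content_dominatesP mr [N [mN N0 NQ]]; exists N; split => //.
exact: mr.
Qed.

Section nonneg_density.
Context d (T : measurableType d) (R : realType) (m r : probability T R).
Hypothesis mr : m `<< r.

(** A version of the density of [m] that is nonnegative at every point, whereas
    [density m r] is so only almost everywhere. *)
Definition rn_density (x : T) : R := fine (Radon_Nikodym_SigmaFinite.f m r x).

Let EFin_rn_density x : (rn_density x)%:E = Radon_Nikodym_SigmaFinite.f m r x.
Proof. by rewrite fineK// Radon_Nikodym_SigmaFinite.f_fin_num. Qed.

Lemma rn_density_ge0 x : (0 <= rn_density x)%R.
Proof. by rewrite fine_ge0// Radon_Nikodym_SigmaFinite.f_ge0. Qed.

Lemma rn_density_intg : intg r rn_density.
Proof.
apply: eq_integrable (Radon_Nikodym_SigmaFinite.f_integrable mr) => //.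
by move=> x _; rewrite /= EFin_rn_density.
Qed.

Lemma rn_density_integral A : measurable A -> m A = \int[r]_(x in A)
  (rn_density x)%:E.
Proof.
move=> mA; rewrite (Radon_Nikodym_SigmaFinite.f_integral mr mA).
by apply: eq_integral => x _; rewrite EFin_rn_density.
Qed.

Lemma rn_density_changee (F : T -> \bar R) : measurable_fun setT F ->
  (forall x, 0 <= F x) -> \int[r]_x (F x * (rn_density x)%:E) = \int[m]_x F x.
Proof.
move=> mF F0; rewrite -(Radon_Nikodym_SigmaFinite.change_of_variables mr)//.
by apply: eq_integral => x _; rewrite EFin_rn_density.
Qed.

Lemma rn_density_change (F : T -> R) : measurable_fun setT F ->
  (forall x, 0 <= F x)%R -> \int[r]_x (F x * rn_density x)%:E = \int[m]_x (F
    x)%:E.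
Proof. by move=> mF F0; rewrite -rn_density_changee//;
  exact/measurable_EFinP. Qed.

Lemma rn_densityE : rn_density = density m r %[ae r].
Proof.
have := ae_eq_Radon_Nikodym_SigmaFinite mr measurableT.
by apply: filterS => x /= + _ => /(_ I) e; rewrite /rn_density /density e.
Qed.

End nonneg_density.

Section change_of_density.
Context d (T : measurableType d) (R : realType) (m r : probability T R).
Variable Z : T -> R.
Hypotheses (Zi : intg r Z)
  (mZ : forall A, measurable A -> m A = \int[r]_(x in A) (Z x)%:E).

Let mfZ : measurable_fun setT Z. Proof. exact: (intg_meas Zi). Qed.

Lemma dens_dominates : m `<< r.
Proof.
apply/null_content_dominatesP => A mA rA0; rewrite mZ//.
apply: null_set_integral => //.
exact/measurable_funTS/measurable_EFinP.
Qed.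

Lemma dens_rn_density : rn_density m r = Z %[ae r].
Proof.
have mr := dens_dominates.
have : ae_eq r setT (EFin \o rn_density m r) (EFin \o Z).
  apply: integral_ae_eq => //;
    [exact: rn_density_intg|exact: measurable_int Zi|].
  by move=> E _ mE; rewrite -(rn_density_integral mr)// mZ.
by apply: filterS => x + _ => /(_ I)[].
Qed.

Lemma dens_ge0 : \forall x \ae r, (0 <= Z x)%R.
Proof.
by apply: filterS dens_rn_density => x /(_ I) <-;
  exact: rn_density_ge0 dens_dominates _.
Qed.

Lemma ge0_dens_integral (F : T -> R) : measurable_fun setT F -> (forall x,
  0 <= F x)%R ->
  \int[r]_x (F x * Z x)%:E = \int[m]_x (F x)%:E.
Proof.
move=> mF F0; rewrite -(rn_density_change dens_dominates)//.
have mrnd := intg_meas (rn_density_intg dens_dominates).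
apply: ae_eq_integral => //.
- by apply/measurable_EFinP; meas.
- by apply/measurable_EFinP; meas.
- by apply: filterS dens_rn_density => x /(_ I) <- _.
Qed.

Lemma dens_intg (F : T -> R) : measurable_fun setT F ->
  intg m F <-> intg r (fun x => F x * Z x)%R.
Proof.
move=> mF; have mrnd := intg_meas (rn_density_intg dens_dominates).
have aeF : (fun x => F x * rn_density m r x)%R = (fun x => F x * Z x)%R %[ae r].
  by apply: filterS dens_rn_density => x /(_ I) <- _.
have mFZ : measurable_fun setT (fun x => F x * Z x)%R by meas.
have mFr : measurable_fun setT (fun x => F x * rn_density m r x)%R by meas.
have maF : measurable_fun setT (fun x => `|F x|)%R by meas.
have eqF : \int[r]_x (`|F x| * rn_density m r x)%:E = \int[m]_x `|F x|%:E.
  by rewrite (rn_density_change dens_dominates).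
have eqr x : (`|F x| * rn_density m r x = `|F x * rn_density m r x|)%R.
  by rewrite normrM (ger0_norm (rn_density_ge0 dens_dominates x)).
split=> Fi.
- apply: ae_intg aeF _ => //; apply/integrableP; split.
    exact/measurable_EFinP.
  move/integrableP : Fi => [_]; apply: le_lt_trans.
  rewrite /= -eqF le_eqVlt; apply/orP; left; apply/eqP.
  by apply: eq_integral => x _; rewrite eqr.
- apply/integrableP; split; first exact/measurable_EFinP.
  rewrite /= -eqF.
  have /integrableP[_] : intg r (fun x => F x * rn_density m r x)%R.
    by apply: ae_intg Fi => //; exact: ae_eq_sym.
  by under [X in _ -> X < _]eq_integral => x _ do rewrite eqr.
Qed.

Lemma dens_Rint (F : T -> R) : intg m F -> (\int[r]_x (F x * Z x) = \int[m]_x F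
  x)%R.
Proof.
move=> Fi; have mF := intg_meas Fi.
have aFi := intg_abs Fi; have sFi := intgD aFi Fi.
have ge G : intg m G -> (forall x, 0 <= G x)%R ->
    (\int[r]_x (G x * Z x) = \int[m]_x G x)%R.
  by move=> Gi G0; rewrite /Rintegral ge0_dens_integral//;
    exact: (intg_meas Gi).
transitivity (\int[r]_x ((`|F x| + F x) * Z x - `|F x| * Z x))%R.
  by apply: eq_Rintegral => x _; ring.
rewrite RintegralB//; last 2 first.
- by apply/(dens_intg (intg_meas sFi)).
- by apply/(dens_intg (intg_meas aFi)).
rewrite !ge//; first by rewrite RintegralD// addrAC subrr add0r.
by move=> x; rewrite -lerBlDr sub0r -normrN ler_norm.
Qed.

End change_of_density.

Definition measure_image d d' (T : measurableType d) (T' : measurableType d')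
    (R : realType) (phi : T -> T') (m : probability T R) (m' : probability T'
      R) :=
  forall A, measurable A -> m (phi @^-1` A) = m' A.

Section image_measure.
Context d d' (T : measurableType d) (T' : measurableType d') (R : realType).
Variables (phi : T -> T') (m : probability T R) (m' : probability T' R).
Hypotheses (mphi : measurable_fun setT phi) (mm' : measure_image phi m m').

Lemma ge0_image_integral (F : T' -> R) : measurable_fun setT F ->
  (forall x, 0 <= F x)%R -> \int[m]_x (F (phi x))%:E = \int[m']_x (F x)%:E.
Proof.
move=> mF F0.
have := @ge0_integral_pushforward _ _ _ _ _ _ mphi m setT (EFin \o F)
  measurableT.
rewrite preimage_setT /comp => <-//; last 2 first.
- exact/measurable_EFinP.
- by move=> x _; rewrite lee_fin.
by apply: eq_measure_integral => A mA _; exact: mm'.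
Qed.

Lemma image_intg (F : T' -> R) : measurable_fun setT F ->
  intg m (fun x => F (phi x)) <-> intg m' F.
Proof.
move=> mF; have maF : measurable_fun setT (fun x => `|F x|)%R by meas.
have e : \int[m]_x (`|F (phi x)|)%:E = \int[m']_x `|F x|%:E.
  exact: (ge0_image_integral maF).
split=> /integrableP[_ Foo]; apply/integrableP; split.
- exact/measurable_EFinP.
- by rewrite /= -e.
- exact/measurable_EFinP/(measurableT_comp mF).
- by rewrite /= e.
Qed.

Lemma image_Rint (F : T' -> R) : intg m' F ->
  (\int[m]_x F (phi x) = \int[m']_x F x)%R.
Proof.
move=> Fi; have mF := intg_meas Fi.
have aFi := intg_abs Fi; have sFi := intgD aFi Fi.
have ge G : intg m' G -> (forall x, 0 <= G x)%R ->
    (\int[m]_x G (phi x) = \int[m']_x G x)%R.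
  by move=> Gi G0; rewrite /Rintegral ge0_image_integral//;
    exact: (intg_meas Gi).
transitivity (\int[m]_x ((`|F (phi x)| + F (phi x)) - `|F (phi x)|))%R.
  by apply: eq_Rintegral => x _; ring.
rewrite RintegralB//; last 2 first.
- exact/(image_intg (intg_meas sFi)).
- exact/(image_intg (intg_meas aFi)).
rewrite (ge (fun x => `|F x| + F x)%R)// ?(ge (fun x => `|F x|)%R)//.
  by rewrite RintegralD// addrAC subrr add0r.
by move=> x; rewrite -lerBlDr sub0r -normrN ler_norm.
Qed.

Lemma image_ae (Q : T' -> Prop) :
  (\forall x \ae m', Q x) -> \forall x \ae m, Q (phi x).
Proof.
move=> [N [mN N0 NQ]]; exists (phi @^-1` N); split.
- by rewrite -[X in measurable X]setTI; exact: mphi.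
- by rewrite mm'.
- by move=> x /= nQ; apply: NQ.
Qed.

End image_measure.

(** * Compactness of decreasing midpoint-convex families *)

Section japanese_bracket.
Context (R : realType).
Implicit Types s t : R.

(** The Japanese bracket, that is, the Euclidean norm of the vector [(1, t)]. *)
Definition jap t : R := Num.sqrt (1 + t ^+ 2).

Lemma jap_sq t : (jap t ^+ 2 = 1 + t ^+ 2)%R.
Proof. by rewrite sqr_sqrtr// addr_ge0// sqr_ge0. Qed.

Lemma jap_ge1 t : (1 <= jap t)%R.
Proof. by rewrite -[leLHS]sqrtr1 ler_wsqrtr// lerDl sqr_ge0. Qed.

Lemma jap_le t : (jap t <= 1 + `|t|)%R.
Proof.
rewrite -(@ler_pXn2r _ 2)// ?nnegrE ?addr_ge0//; last first.
  exact: le_trans (jap_ge1 t).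
rewrite jap_sq -[(t ^+ 2)%R]real_normK ?num_real//.
have := normr_ge0 t; nra.
Qed.

Lemma jap_gt0 t : (0 < jap t)%R.
Proof. exact: lt_le_trans (jap_ge1 t). Qed.

Lemma continuous_jap : continuous jap.
Proof.
move=> t; have c1 : (fun x : R => 1 + x ^+ 2)%R @ t --> (1 + t ^+ 2)%R.
  by apply: cvgD; [exact: cvg_cst|exact: exprn_continuous].
rewrite /continuous_at /jap.
by apply: (continuous_cvg _ _ c1); exact: sqrt_continuous.
Qed.

(** For vectors [u] and [v] of norm at least 1, [|u| + |v| - |u + v|] dominates
    a quarter of the squared distance between the directions [u / |u|] and
    [v / |v|]; here [u = (1, s)] and [v = (1, t)]. *)
Lemma jap_defect s t :
  ((s / jap s - t / jap t) ^+ 2 + ((jap s)^-1 - (jap t)^-1) ^+ 2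
    <= 4 * (jap s + jap t - 2 * jap ((s + t) / 2)))%R.
Proof.
set p := jap s; set q := jap t; set w := (2 * jap ((s + t) / 2))%R.
have p1 : (1 <= p)%R := jap_ge1 s.
have q1 : (1 <= q)%R := jap_ge1 t.
have w0 : (0 <= w)%R by rewrite mulr_ge0//; exact: ltW (jap_gt0 _).
have pE : (p ^+ 2 = 1 + s ^+ 2)%R := jap_sq s.
have qE : (q ^+ 2 = 1 + t ^+ 2)%R := jap_sq t.
have wE : (w ^+ 2 = 4 + (s + t) ^+ 2)%R.
  by rewrite exprMn jap_sq; field.
have pq : (1 <= p * q)%R by nra.
have p0 : p != 0%R by rewrite gt_eqF// jap_gt0.
have q0 : q != 0%R by rewrite gt_eqF// jap_gt0.
(* Both members are [|u| |v|] times the squared distance of the directions. *)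
have DE : (((s / p - t / q) ^+ 2 + (p^-1 - q^-1) ^+ 2) * (p * q)
    = 2 * (p * q) - 2 - 2 * s * t)%R.
  have sE : (s ^+ 2 = p ^+ 2 - 1)%R by rewrite pE; ring.
  have tE : (t ^+ 2 = q ^+ 2 - 1)%R by rewrite qE; ring.
  transitivity ((s ^+ 2 + 1) * q / p + (t ^+ 2 + 1) * p / q - 2 - 2 * s * t)%R.
    by field; rewrite p0 q0.
  by rewrite sE tE; field; rewrite p0 q0.
have fact : ((p + q - w) * (p + q + w) = 2 * (p * q) - 2 - 2 * s * t)%R.
  rewrite -subr_sqr wE sqrrD pE qE; ring.
set D := (X in (X <= _)%R).
have D0 : (0 <= D)%R by rewrite addr_ge0// sqr_ge0.
have pqw : (0 <= p + q - w)%R.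
  rewrite -(@pmulr_lge0 _ (p + q + w)); last by nra.
  by rewrite fact -DE mulr_ge0//; nra.
rewrite -(@ler_pM2r _ (p * q)); last by nra.
rewrite DE -fact.
have : (p + q + w <= 4 * (p * q))%R by nra.
move=> /(ler_wpM2l pqw); nra.
Qed.

End japanese_bracket.

Section pointwise_limits.
Context d (T : measurableType d) (R : realType) (m : probability T R).

Lemma cvg_fin (u : R^nat) (l : R) :
  u @ \oo --> l -> (EFin \o u) @ \oo --> l%:E.
Proof. by move=> ul; apply: cvg_EFin => //; exact: nearW. Qed.

Lemma measurable_limn_einf (F : (T -> \bar R)^nat) :
  (forall k, measurable_fun setT (F k)) ->
  measurable_fun setT (fun x => limn_einf (F^~ x)).
Proof.
move=> mF; rewrite (_ : (fun _ => _) =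
    -%E \o (fun x => limn_esup (-%E \o (F^~ x)))).
  apply: measurableT_comp => //; apply: measurable_fun_limn_esup => k.
  exact: measurableT_comp.
by apply/funext => x /=; rewrite limn_esupN oppeK.
Qed.

Lemma limn_einf_le (u : (\bar R)^nat) (C : R^nat) (c : R) :
  (forall n, u n <= (C n)%:E) -> C @ \oo --> c -> limn_einf u <= c%:E.
Proof.
move=> uC Cc; rewrite limn_einf_lim.
have cC : (EFin \o C) @ \oo --> c%:E by exact: cvg_fin.
rewrite -(cvg_lim _ cC)//; apply: lee_lim.
- exact: is_cvg_einfs.
- by apply/cvg_ex; exists c%:E.
- apply: nearW => n; apply: le_trans (uC n).
  by apply: ereal_inf_lbound; exists n => /=.
Qed.

Lemma fatou_bound (F : (T -> R)^nat) (G : T -> R) (C : R^nat) (c : R) :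
  (forall k, measurable_fun setT (F k)) -> (forall k x, 0 <= F k x)%R ->
  measurable_fun setT G -> (forall x, 0 <= G x)%R ->
  (forall k, \int[m]_x (F k x)%:E <= (C k)%:E) -> C @ \oo --> c ->
  (\forall x \ae m, F^~ x @ \oo --> G x) ->
  \int[m]_x (G x)%:E <= c%:E.
Proof.
move=> mF F0 mG G0 FC Cc FG.
have mFE k : measurable_fun setT (fun x =>
  (F k x)%:E) by exact/measurable_EFinP.
apply: le_trans (limn_einf_le FC Cc).
apply: le_trans (fatou m measurableT mFE _); last first.
  by move=> n x _; rewrite lee_fin.
rewrite le_eqVlt; apply/orP; left; apply/eqP; apply: ae_eq_integral => //.
- exact/measurable_EFinP.
- exact: measurable_limn_einf.
- apply: filterS FG => x Fx _.
  by have := cvg_limn_einf_sup (cvg_fin Fx) => -[/esym].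
Qed.

End pointwise_limits.

Section ae_convergence.
Context d (T : measurableType d) (R : realType) (m : probability T R).

(** As [|d| <= 2^k d^2 + 2^-k], the geometric decay of the [L^2] norms makes the
    increments absolutely summable almost everywhere. *)
Lemma ae_cvg_sq_increments (F : (T -> R)^nat) (K : R) :
  (forall k, measurable_fun setT (F k)) ->
  (forall k, \int[m]_x ((F k.+1 x - F k x) ^+ 2)%:E <= (K / 8 ^+ k)%:E) ->
  \forall x \ae m, cvgn (F^~ x).
Proof.
move=> mF FK; pose D k x := (F k.+1 x - F k x)%R.
have mD k : measurable_fun setT (D k) by apply: measurable_funB.
have mDE k : measurable_fun setT (fun x => (`|D k x|)%:E).
  by apply/measurable_EFinP; meas.
have K0 : (0 <= K)%R.
  rewrite -lee_fin -[K]divr1 -(expr0 8); apply: le_trans (FK 0%N).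
  by apply: integral_ge0 => x _; rewrite lee_fin sqr_ge0.
have DK k : \int[m]_x (`|D k x|)%:E <= (2 * (K + 1) / (2 ^ k.+1)%:R)%:E.
  have p0 : (0 < 2 ^+ k :> R)%R by rewrite exprn_gt0.
  apply: (@le_trans _ _ (\int[m]_x ((2 ^+ k * D k x ^+ 2)%:E + (2 ^- k)%:E))%E).
    apply: ge0_le_integral => //.
    - by apply: emeasurable_funD => //; apply/measurable_EFinP; meas.
    - move=> x _; rewrite -EFinD lee_fin -[(D k x ^+ 2)%R]real_normK
      ?num_real//.
      rewrite -(@ler_pM2l _ (2 ^+ k))// mulrDr divff ?gt_eqF//.
      have := normr_ge0 (D k x); nra.
  have p0' := ltW p0.
  have D20 x : setT x -> 0 <= (2 ^+ k * D k x ^+ 2)%:E.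
    by move=> _; rewrite lee_fin mulr_ge0 ?sqr_ge0// ltW.
  have mD2 : measurable_fun setT (fun x => (2 ^+ k * D k x ^+ 2)%:E).
    by apply/measurable_EFinP; meas.
  rewrite ge0_integralD//.
  under eq_integral do rewrite EFinM.
  rewrite ge0_integralZl_EFin//; last 2 first.
  - by move=> x _; rewrite lee_fin sqr_ge0.
  - by apply/measurable_EFinP; meas.
  rewrite integral_cst// [X in _ + _ * X](@probability_setT _ _ _ m) mule1.
  apply: (@le_trans _ _ ((2 ^+ k)%:E * (K / 8 ^+ k)%:E + (2 ^- k)%:E)%E).
    by rewrite leeD2r// lee_pmul2l// FK.
  rewrite -EFinM -EFinD lee_fin natrX exprS.
  have -> : (8 = 2 * (2 * 2) :> R)%R by ring.
  rewrite !exprMn.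
  have q1 : (1 <= 2 ^+ k :> R)%R by rewrite exprn_ege1// ler1n.
  set q := (2 ^+ k)%R in p0 q1 *.
  have q0 : q != 0%R by rewrite gt_eqF.
  have -> : (q * (K / (q * (q * q))) = (K / q) / q)%R by field.
  have -> : (2 * (K + 1) / (2 * q) = K / q + q^-1)%R by field.
  by rewrite lerD2r ler_pdivrMr// ler_peMr// divr_ge0// ltW.
have sumD : \int[m]_x (\sum_(0 <= k <oo) (`|D k x|)%:E) <= (2 * (K + 1))%:E.
  rewrite integral_nneseries//.
  apply: le_trans (@epsilon_trick0 _ _ xpredT _); last by lra.
  by apply: lee_nneseries => // k _ _; exact: integral_ge0.
have : m.-integrable setT (fun x => \sum_(0 <= k <oo) (`|D k x|)%:E).
  apply/integrableP; split.
    by apply: ge0_emeasurable_sum => // k x _.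
  under eq_integral => x _ do rewrite gee0_abs ?nneseries_ge0//.
  by rewrite (le_lt_trans sumD)// ltry.
move/(integrable_ae measurableT); apply: filterS => x /(_ I) finx.
have Dx : cvgn (series (telescope (F^~ x))).
  apply: normed_cvg; apply: nondecreasing_is_cvgn.
    by apply: nondecreasing_series => n _ _ /=; exact: normr_ge0.
  exists (fine (\sum_(0 <= k <oo) (`|D k x|)%:E)) => _ [n _ <-].
  rewrite -lee_fin fineK// /series/= -sumEFin.
  by apply: nneseries_lim_ge.
rewrite telescopeK in Dx.
rewrite (_ : F^~ x = (fun n => (F n x - F 0%N x) + F 0%N x)%R).
  by apply: is_cvgD => //; exact: is_cvg_cst.
by apply/funext => n; rewrite subrK.
Qed.

Lemma ae_not_cvgy (F : (T -> R)^nat) (c : R) :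
  (forall k, measurable_fun setT (F k)) -> (forall k x, 0 <= F k x)%R ->
  (forall k, \int[m]_x (F k x)%:E <= c%:E) ->
  \forall x \ae m, ~ (F^~ x @ \oo --> +oo%R).
Proof.
move=> mF F0 Fc.
have mFE k : measurable_fun setT (fun x =>
  (F k x)%:E) by exact/measurable_EFinP.
have : m.-integrable setT (fun x => limn_einf (fun k => (F k x)%:E)).
  apply/integrableP; split.
    exact: measurable_limn_einf.
  under eq_integral => x _.
    rewrite gee0_abs; last first.
      rewrite limn_einf_lim; apply: lime_ge; first exact: is_cvg_einfs.
      by apply: nearW => n; apply: le_ereal_inf_tmp => _ [k _ <-];
        rewrite lee_fin.
    over.
  have F0E n x : setT x -> 0 <= (F n x)%:E by rewrite lee_fin.
  apply: (le_lt_trans (fatou m measurableT mFE F0E)).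
  apply: (@le_lt_trans _ _ c%:E); last exact: ltry.
  by apply: (limn_einf_le (C := cst c)) => //; exact: cvg_cst.
move/(integrable_ae measurableT); apply: filterS => x /(_ I) + Foo.
have Fey : (EFin \o (F^~ x)) @ \oo --> +oo by exact/cvgeryP.
by have [-> _] := cvg_limn_einf_sup Fey.
Qed.

End ae_convergence.

Section convex_compactness.
Context d (T : measurableType d) (R : realType) (m : probability T R).
Variables (S : nat -> set (T -> R)) (M : R).
Hypotheses (S_intg : forall n h, S n h -> intg m h)
  (S_bounded : forall n h, S n h -> (\int[m]_x `|h x| <= M)%R)
  (S_neq0 : forall n, S n !=set0)
  (S_decr : forall n k, (n <= k)%N -> S k `<=` S n)
  (S_mid : forall n h1 h2, S n h1 -> S n h2 ->
    S n (fun x => (h1 x + h2 x) / 2)%R).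

Let Phi (h : T -> R) : R := (\int[m]_x jap (h x))%R.

Let jap_intg n h : S n h -> intg m (fun x => jap (h x)).
Proof.
move=> Sh; have hi := S_intg Sh; have mh := intg_meas hi.
apply: (intg_le (g := fun x => (1 + `|h x|)%R)).
- exact: (measurableT_comp (continuous_measurable_fun (@continuous_jap R)) mh).
- by apply: intgD; [exact: intg_cst|exact: intg_abs].
- by move=> x; rewrite gtr0_norm ?jap_gt0//; exact: jap_le.
Qed.

Let Phi_ge0 h : (0 <= Phi h)%R.
Proof. by apply: Rintegral_ge0 => x _; exact/ltW/jap_gt0. Qed.

Let Phi_le n h : S n h -> (Phi h <= 1 + M)%R.
Proof.
move=> Sh; have hi := S_intg Sh.
apply: (@le_trans _ _ (\int[m]_x (1 + `|h x|))%R).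
  apply: le_Rintegral => //; first exact: jap_intg Sh.
    by apply: intgD; [exact: intg_cst|exact: intg_abs].
  by move=> x _; exact: jap_le.
rewrite RintegralD//; [|exact: intg_cst|exact: intg_abs].
by rewrite Rint_cst lerD2l; exact: S_bounded Sh.
Qed.

Let s n : R := inf (Phi @` S n).

Let has_inf_Phi n : has_inf (Phi @` S n).
Proof.
split; first by have [h Sh] := S_neq0 n; exists (Phi h), h.
by exists 0%R => _ [h _ <-].
Qed.

Let s_le n h : S n h -> (s n <= Phi h)%R.
Proof. by move=> Sh; apply: (inf_lbound (has_inf_Phi n).2); exists h. Qed.

Let s_homo n k : (n <= k)%N -> (s n <= s k)%R.
Proof.
move=> nk; apply: lb_le_inf; first exact: (has_inf_Phi k).1.
by move=> _ [h Sh <-]; apply: s_le; exact: S_decr Sh.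
Qed.

Let has_sup_s : has_sup (range s).
Proof.
split; first by exists (s 0%N), 0%N.
exists (1 + M)%R => _ [n _ <-]; have [h Sh] := S_neq0 n.
exact: le_trans (s_le Sh) (Phi_le Sh).
Qed.

Let near_minimizer k : exists nh : nat * (T -> R),
  [/\ (k <= nh.1)%N, S nh.1 nh.2, (sup (range s) - 1 / 8 ^+ k <= s nh.1)%R
    & (Phi nh.2 <= sup (range s) + 1 / 8 ^+ k)%R].
Proof.
have e0 : (0 < 1 / 8 ^+ k :> R)%R by rewrite divr_gt0// exprn_gt0.
have [_ [n _ <-] sn] := sup_adherent e0 has_sup_s.
have [_ [h Sh <-] hs] := inf_adherent e0 (has_inf_Phi (maxn n k)).
exists (maxn n k, h); split => //=.
- exact: leq_maxr.
- by rewrite (le_trans (ltW sn))// s_homo// leq_maxl.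
- rewrite (le_trans (ltW hs))// lerD2r; apply: sup_ubound => //.
  exact: has_sup_s.2.
Qed.

(** Among the members of the family at level [n], choose one nearly minimising
    the strictly convex functional [Phi]. Two consecutive choices and their
    midpoint then have almost the same value of [Phi], so [jap_defect] makes
    the bounded functions [h / jap h] and [1 / jap h] converge almost everywhere;
    Fatou's lemma excludes the limit 0 for [1 / jap h]. *)
Lemma convex_ae_cvg : exists h : nat -> T -> R,
  (forall k, S k (h k)) /\ \forall x \ae m, cvgn (h^~ x).
Proof.
have [nh nhP] := choice near_minimizer.
pose h k := (nh k).2; pose s0 := sup (range s).
have Sh k : S (nh k).1 (h k) by have [] := nhP k.
have mh k : measurable_fun setT (h k) := intg_meas (S_intg (Sh k)).
have jh k : intg m (fun x => jap (h k x)) by exact: jap_intg (Sh k).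
have mj k : measurable_fun setT (fun x => jap (h k x)) := intg_meas (jh k).
pose u k x := (jap (h k x))^-1%R; pose v k x := (h k x / jap (h k x))%R.
have mu k : measurable_fun setT (u k).
  have cu : continuous (fun t : R => (jap t)^-1%R).
    move=> t; apply: cvgV; first by rewrite gt_eqF// jap_gt0.
    exact: continuous_jap.
  exact: (measurableT_comp (continuous_measurable_fun cu) (mh k)).
have mv k : measurable_fun setT (v k) := measurable_funM (mh k) (mu k).
have [mid midE] : exists mid : nat -> T -> R,
    (forall k x, mid k x = ((h k.+1 x + h k x) / 2)%R) /\
    forall k, intg m (fun x => jap (mid k x)) /\
      (s0 - 1 / 8 ^+ k <= Phi (mid k))%R.
  exists (fun k x => ((h k.+1 x + h k x) / 2)%R); split=> // k.
  have [nk|nk] := leqP (nh k).1 (nh k.+1).1.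
  - have Sm : S (nh k).1 (fun x => ((h k.+1 x + h k x) / 2)%R).
      by apply: S_mid => //; exact: S_decr nk _ (Sh k.+1).
    split; first exact: jap_intg Sm.
    by have [_ _ sk _] := nhP k; apply: le_trans sk (s_le Sm).
  - have Sm : S (nh k.+1).1 (fun x => ((h k.+1 x + h k x) / 2)%R).
      by apply: S_mid => //; exact: S_decr (ltnW nk) _ (Sh k).
    split; first exact: jap_intg Sm.
    have [_ _ sk _] := nhP k.+1; apply: le_trans (le_trans sk (s_le Sm)).
    rewrite lerD2l lerN2 ler_pM2l// lef_pV2 ?posrE ?exprn_gt0//.
    by rewrite ler_eXn2l// ltr1n.
have defect k : (\int[m]_x ((v k.+1 x - v k x) ^+ 2 + (u k.+1 x - u k x) ^+ 2)
    <= 16 / 8 ^+ k)%R /\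
    intg m (fun x => (v k.+1 x - v k x) ^+ 2 + (u k.+1 x - u k x) ^+ 2)%R.
  have [/(_ k) mE /(_ k) [mi mPhi]] := midE.
  pose G x := (4 * (jap (h k.+1 x) + jap (h k x) - 2 * jap (mid k x)))%R.
  have Gi : intg m G.
    by apply: intgZ; apply: intgB;
      [exact: (intgD (jh _) (jh _))|exact: (intgZ _ mi)].
  have vuG x : ((v k.+1 x - v k x) ^+ 2 + (u k.+1 x - u k x) ^+ 2 <= G x)%R.
    by rewrite /G mE; exact: jap_defect.
  have vui : intg m (fun x => (v k.+1 x - v k x) ^+ 2 +
      (u k.+1 x - u k x) ^+ 2)%R.
    apply: intg_le Gi _; first by meas.
    by move=> x; rewrite ger0_norm// addr_ge0// sqr_ge0.
  split=> //; apply: (@le_trans _ _ (\int[m]_x G x)%R).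
    by apply: le_Rintegral => // x _; exact: vuG.
  rewrite /G RintegralZl//; last by apply: intgB;
    [exact: (intgD (jh _) (jh _))|exact: (intgZ _ mi)].
  rewrite RintegralB//; [|exact: intgD|exact: intgZ].
  rewrite RintegralD// RintegralZl//.
  have [_ _ _ Pk] := nhP k; have [_ _ _ Pk1] := nhP k.+1.
  have e8 : (1 / 8 ^+ k.+1 <= 1 / 8 ^+ k :> R)%R.
    by rewrite ler_pM2l// lef_pV2 ?posrE ?exprn_gt0// ler_eXn2l// ltr1n.
  move: Pk Pk1 mPhi e8; rewrite -/(h k) -/(h k.+1) /Phi -/s0.
  have -> : (16 / 8 ^+ k = 16 * (1 / 8 ^+ k) :> R)%R by rewrite mul1r.
  set e := (1 / 8 ^+ k)%R; lra.
have sq_bound (w : nat -> T -> R) : (forall k, measurable_fun setT (w k)) ->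
    (forall k x, (w k.+1 x - w k x) ^+ 2 <=
      (v k.+1 x - v k x) ^+ 2 + (u k.+1 x - u k x) ^+ 2)%R ->
    \forall x \ae m, cvgn (w^~ x).
  move=> mw wle; apply: (ae_cvg_sq_increments (K := 16)) => // k.
  have [dle di] := defect k.
  rewrite -EFin_Rint; last first.
    apply: intg_le di _; first by meas.
    by move=> x; rewrite ger0_norm ?sqr_ge0.
  rewrite lee_fin (le_trans _ dle)//; apply: le_Rintegral => //.
  apply: intg_le di _; first by meas.
  by move=> x; rewrite ger0_norm ?sqr_ge0.
have ucvg : \forall x \ae m, cvgn (u^~ x).
  by apply: sq_bound => // k x; rewrite lerDr sqr_ge0.
have vcvg : \forall x \ae m, cvgn (v^~ x).
  by apply: sq_bound => // k x; rewrite lerDl sqr_ge0.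
have jnoty : \forall x \ae m, ~ ((fun k => jap (h k x)) @ \oo --> +oo%R).
  apply: (ae_not_cvgy (c := (1 + M)%R)) => //.
    by move=> k x; exact/ltW/jap_gt0.
  by move=> k; rewrite -EFin_Rint// lee_fin; exact: Phi_le (Sh k).
exists h; split.
  by move=> k; have [kn _ _ _] := nhP k; exact: S_decr kn _ (Sh k).
apply: filterS3 ucvg vcvg jnoty => x uc vc jn.
have u0 : lim (u^~ x @ \oo) != 0%R.
  apply/eqP => l0; apply: jn.
  have : u^~ x @ \oo --> 0%R by rewrite -l0.
  by move/gtr0_cvgV0; apply; apply: nearW => k; exact: jap_gt0.
rewrite (_ : h^~ x = (fun k => v k x * (u k x)^-1)%R).
  by apply: is_cvgM => //; exact: is_cvgV.
apply/funext => k; rewrite /v /u invrK mulfVK//.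
by rewrite gt_eqF// jap_gt0.
Qed.

End convex_compactness.

(** * Product measures *)

Section product_measures.
Context (R : realType) d1 d2 (X : measurableType d1) (Y : measurableType d2).
Variables (mu : probability X R) (nu : probability Y R).

Lemma refm_fst : measure_image fst (refm mu nu) mu.
Proof.
move=> A mA; rewrite -setXT /refm/= product_measure1E//.
by rewrite [X in _ * X](@probability_setT _ _ _ nu) mule1.
Qed.

Lemma refm_snd : measure_image snd (refm mu nu) nu.
Proof.
move=> A mA; rewrite -setTX /refm/= product_measure1E//.
by rewrite [X in X * _](@probability_setT _ _ _ mu) mul1e.
Qed.

Lemma refm_tonelli1 (F : X * Y -> R) : measurable_fun setT F ->
  (forall z, 0 <= F z)%R ->
  \int[refm mu nu]_z (F z)%:E = \int[mu]_x \int[nu]_y (F (x, y))%:E.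
Proof.
move=> mF F0; rewrite /refm /= (fubini_tonelli1 (EFin \o F))//.
exact/measurable_EFinP.
Qed.

Lemma refm_tonelli2 (F : X * Y -> R) : measurable_fun setT F ->
  (forall z, 0 <= F z)%R ->
  \int[refm mu nu]_z (F z)%:E = \int[nu]_y \int[mu]_x (F (x, y))%:E.
Proof.
move=> mF F0; rewrite /refm /= (fubini_tonelli2 (EFin \o F))//.
exact/measurable_EFinP.
Qed.

Lemma measurable_int1 (F : X * Y -> R) : measurable_fun setT F ->
  (forall z, 0 <= F z)%R ->
  measurable_fun setT (fun x => \int[nu]_y (F (x, y))%:E).
Proof.
move=> mF F0; apply: (measurable_fun_fubini_tonelli_F (EFin \o F)) => //.
exact/measurable_EFinP.
Qed.

Lemma measurable_int2 (F : X * Y -> R) : measurable_fun setT F ->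
  (forall z, 0 <= F z)%R ->
  measurable_fun setT (fun y => \int[mu]_x (F (x, y))%:E).
Proof.
move=> mF F0; apply: (measurable_fun_fubini_tonelli_G (EFin \o F)) => //.
exact/measurable_EFinP.
Qed.

Lemma ge0_int_eq0 d (T : measurableType d) (m : {measure set T -> \bar R})
    (F : T -> \bar R) : measurable_fun setT F -> (forall x, 0 <= F x) ->
  \int[m]_x F x = 0 -> \forall x \ae m, F x = 0.
Proof.
move=> mF F0 i0; have : \int[m]_x `|F x| = 0.
  by under eq_integral => x _ do rewrite gee0_abs//.
move/(ae_eq_integral_abs m measurableT mF).
by apply: filterS => x /(_ I).
Qed.

Lemma ae_sections (Q : X * Y -> Prop) : (\forall z \ae refm mu nu, Q z) ->
  (\forall x \ae mu, \forall y \ae nu, Q (x, y)) /\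
  (\forall y \ae nu, \forall x \ae mu, Q (x, y)).
Proof.
move=> [N [mN N0 NQ]].
pose F : X * Y -> R := \1_N.
have mF : measurable_fun setT F by exact: measurable_indic.
have F0 z : (0 <= F z)%R by rewrite /F indicE.
have iF : \int[refm mu nu]_z (F z)%:E = 0 by rewrite integral_indic// setIT.
have F0E x y : setT y -> 0 <= (F (x, y))%:E by rewrite lee_fin.
have F0E' y x : setT x -> 0 <= (F (x, y))%:E by rewrite lee_fin.
have mFE : measurable_fun setT (EFin \o F) by exact/measurable_EFinP.
have mF1 x : measurable_fun setT (fun y => (F (x, y))%:E).
  exact: (measurableT_comp mFE (pair1_measurable x)).
have mF2 y : measurable_fun setT (fun x => (F (x, y))%:E).
  exact: (measurableT_comp mFE (pair2_measurable y)).
have notN z : (F z)%:E = 0 -> Q z.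
  move=> Fz; apply: contrapT => /NQ Nz.
  by move: Fz; rewrite /F indicE mem_set// => -[/eqP]; rewrite oner_eq0.
split.
- have : \int[mu]_x \int[nu]_y (F (x, y))%:E = 0 by rewrite -refm_tonelli1.
  move/(ge0_int_eq0 (measurable_int1 mF F0)) => H.
  have {}H := H (fun x => integral_ge0 _ (F0E x)).
  apply: filterS H => x /(ge0_int_eq0 (mF1 x)) H.
  by apply: filterS (H (fun y => F0E x y I)) => y; exact: notN.
- have : \int[nu]_y \int[mu]_x (F (x, y))%:E = 0 by rewrite -refm_tonelli2.
  move/(ge0_int_eq0 (measurable_int2 mF F0)) => H.
  have {}H := H (fun y => integral_ge0 _ (F0E' y)).
  apply: filterS H => y /(ge0_int_eq0 (mF2 y)) H.
  by apply: filterS (H (fun x => F0E' y x I)) => x; exact: notN.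
Qed.

Lemma ae_witness d (T : measurableType d) (m : probability T R) (Q : T -> Prop)
  :
  (\forall x \ae m, Q x) -> exists x, Q x.
Proof.
move=> [N [mN N0 NQ]]; apply: contrapT => /forallNP nQ.
have NT : N = setT by apply/seteqP; split => // x _; apply: NQ; exact: nQ.
by move: N0; rewrite NT probability_setT => /eqP; rewrite eqe oner_eq0.
Qed.

Lemma ae_cvg_measurable_limit d (T : measurableType d) (m : probability T R)
    (F : (T -> R)^nat) : (forall k, measurable_fun setT (F k)) ->
  (\forall x \ae m, cvgn (F^~ x)) ->
  exists2 G : T -> R, measurable_fun setT G &
    \forall x \ae m, F^~ x @ \oo --> G x.
Proof.
move=> mF Fc; exists (fun x => fine (limn_esup (fun k => (F k x)%:E))).
  apply: measurableT_comp; first exact: fine_measurable.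
  by apply: measurable_fun_limn_esup => k; exact/measurable_EFinP.
apply: filterS Fc => x /cvg_ex[l Fl].
by have [_ ->] := cvg_limn_einf_sup (cvg_fin Fl).
Qed.

(** If [f k (+) g k] converges almost everywhere, freezing [y] at a generic
    [y0] shows that [f k + g k y0] converges, and freezing [x] that
    [g k - g k y0] does. *)
Lemma ae_cvg_split (f : (X -> R)^nat) (g : (Y -> R)^nat) :
  (forall k, measurable_fun setT (f k)) -> (forall k,
    measurable_fun setT (g k)) ->
  (\forall z \ae refm mu nu, cvgn (fun k => f k z.1 + g k z.2)%R) ->
  exists (r : R^nat) (f0 : X -> R) (g0 : Y -> R),
    [/\ measurable_fun setT f0, measurable_fun setT g0,
        \forall x \ae mu, (fun k => f k x + r k)%R @ \oo --> f0 x
      & \forall y \ae nu, (fun k => g k y - r k)%R @ \oo --> g0 y].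
Proof.
move=> mf mg /ae_sections[aexy aeyx].
have [y0 aey0] := ae_witness aeyx.
have [x0 [cx0 aex0]] := ae_witness (filterI aey0 aexy).
pose r k := g k y0.
have fr : \forall x \ae mu, cvgn (fun k => f k x + r k)%R := aey0.
have gr : \forall y \ae nu, cvgn (fun k => g k y - r k)%R.
  apply: filterS aex0 => y /= cy.
  rewrite (_ : (fun _ => _) =
    (fun k => (f k x0 + g k y) - (f k x0 + g k y0))%R).
    exact: is_cvgB.
  by apply/funext => k; rewrite /r; ring.
have [f0 mf0 ff0] := ae_cvg_measurable_limit
  (fun k => measurable_funD (mf k) (measurable_cst (r k))) fr.
have [g0 mg0 gg0] := ae_cvg_measurable_limit
  (fun k => measurable_funB (mg k) (measurable_cst (r k))) gr.
by exists r, f0, g0.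
Qed.

End product_measures.

Section product_densities.
Context (R : realType) d1 d2 (X : measurableType d1) (Y : measurableType d2).

Lemma intg_prod (m1 : probability X R) (m2 : probability Y R)
    (f : X -> R) (g : Y -> R) : intg m1 f -> intg m2 g ->
  intg (refm m1 m2) (fun z => f z.1 * g z.2)%R.
Proof.
move=> fi gi; have mf := intg_meas fi; have mg := intg_meas gi.
apply/integrableP; split; first by apply/measurable_EFinP; meas.
rewrite /= refm_tonelli1//; last by meas.
have E x : \int[m2]_y (`|f x * g y|)%:E = (`|f x|)%:E * \int[m2]_y (`|g y|)%:E.
  under eq_integral => y _ do rewrite normrM EFinM.
  by rewrite ge0_integralZl_EFin//; apply/measurable_EFinP; meas.
under eq_integral => x _ do rewrite E.
have /integrableP[_ goo] := gi; have /integrableP[_ foo] := fi.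
rewrite ge0_integralZr//.
- by rewrite lte_mul_pinfty//; [exact: integral_ge0|
    exact: (integrable_fin_num measurableT (intg_abs fi))].
- by apply/measurable_EFinP; meas.
- exact: integral_ge0.
Qed.

Variables (mu tmu : probability X R) (nu tnu : probability Y R).
Hypotheses (mutmu : mu `<< tmu) (nutnu : nu `<< tnu).

Definition product_density (z : X * Y) : R :=
  (rn_density mu tmu z.1 * rn_density nu tnu z.2)%R.

(** Tonelli's theorem, with a change of density in each variable. *)
Lemma product_has_density :
  has_density tmu tnu (refm mu nu) product_density.
Proof.
move=> A mA; have ma := intg_meas (rn_density_intg mutmu).
have mb := intg_meas (rn_density_intg nutnu).
have mI : measurable_fun setT (\1_A : _ -> R) by exact: measurable_indic.
have I0 z : (0 <= \1_A z :> R)%R by rewrite indicE.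
have a0 := rn_density_ge0 mutmu; have b0 := rn_density_ge0 nutnu.
have mIs x : measurable_fun setT (fun y => \1_A (x, y) : R).
  exact: (measurableT_comp mI (pair1_measurable x)).
transitivity (\int[refm mu nu]_z (\1_A z)%:E);
  first by rewrite integral_indic// setIT.
rewrite refm_tonelli1//.
have -> : \int[refm tmu tnu]_(z in A) (product_density z)%:E =
    \int[refm tmu tnu]_z (\1_A z * product_density z)%:E.
  rewrite integral_mkcond; apply: eq_integral => z _.
  by rewrite patchE indicE; case: ifPn => zA; rewrite ?mul1r ?mul0r.
rewrite refm_tonelli1//; last 2 first.
- by rewrite /product_density; meas.
- by move=> z; rewrite !mulr_ge0.
transitivity (\int[tmu]_x ((\int[nu]_y (\1_A (x,
  y))%:E) * (rn_density mu tmu x)%:E)).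
  rewrite rn_density_changee//; first exact: measurable_int1.
  by move=> x; apply: integral_ge0 => y _; rewrite lee_fin.
apply: eq_integral => x _.
have -> : \int[tnu]_y (\1_A (x, y) * product_density (x, y))%:E =
    \int[tnu]_y ((rn_density mu tmu x)%:E * (\1_A (x,
      y) * rn_density nu tnu y)%:E).
  by apply: eq_integral => y _; rewrite /product_density/= mulrCA EFinM.
rewrite ge0_integralZl_EFin//; last 2 first.
- by move=> y _; rewrite lee_fin mulr_ge0.
- by apply/measurable_EFinP; meas.
rewrite muleC; congr (_ * _).
by rewrite -(rn_density_changee nutnu (F := fun y => (\1_A (x, y))%:E))//;
  exact/measurable_EFinP.
Qed.

End product_densities.

(** * Weak duality and the duality gap *)

Section duality.
Context (R : realType) d1 d2 (X : measurableType d1) (Y : measurableType d2).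
Variables (mu tmu : probability X R) (nu tnu : probability Y R).
Variable c : X * Y -> R.
Hypothesis SA : standing_assumptions mu nu tmu tnu c.
Notation P := (refm tmu tnu).
Implicit Types (f : X -> R) (g : Y -> R) (Z : X * Y -> R).

Lemma cost_meas : measurable_fun setT c.
Proof. by have /L2P[] := cost_L2 SA. Qed.

Lemma cost_sq_intg : intg P (fun z => c z ^+ 2)%R.
Proof. by have /L2P[] := cost_L2 SA. Qed.

Lemma pospart_meas f g : measurable_fun setT f -> measurable_fun setT g ->
  measurable_fun setT (pospart f g c).
Proof. by move=> mf mg; have mc := cost_meas; rewrite /pospart; meas. Qed.

Lemma pospart_ge0 f g z : (0 <= pospart f g c z)%R.
Proof. by rewrite le_max lexx orbT. Qed.

Lemma pospart_ge f g z : (f z.1 + g z.2 - c z <= pospart f g c z)%R.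
Proof. by rewrite le_max lexx. Qed.

Lemma pospart_cases f g z :
  (pospart f g c z = f z.1 + g z.2 - c z \/ pospart f g c z = 0)%R.
Proof. by rewrite /pospart maxEle; case: ifP => _; [right|left]. Qed.

Section marginals.
Variables (pi : probability (X * Y)%type R) (Z : X * Y -> R).
Hypotheses (pi_coupling : coupling mu nu pi) (Zi : intg P Z)
  (piZ : has_density tmu tnu pi Z).

Let pi_fst : measure_image fst pi mu. Proof. exact: pi_coupling.1. Qed.
Let pi_snd : measure_image snd pi nu. Proof. exact: pi_coupling.2. Qed.

Lemma coupling_sum_intg f g : intg mu f -> intg nu g ->
  intg pi (fun z => f z.1 + g z.2)%R.
Proof.
move=> fi gi; apply: intgD.
  exact/(image_intg measurable_fst pi_fst (intg_meas fi)).
exact/(image_intg measurable_snd pi_snd (intg_meas gi)).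
Qed.

Lemma coupling_sum_Rint f g : intg mu f -> intg nu g ->
  (\int[pi]_z (f z.1 + g z.2) = \int[mu]_x f x + \int[nu]_y g y)%R.
Proof.
move=> fi gi; rewrite RintegralD//.
- by rewrite (image_Rint measurable_fst pi_fst)//
  (image_Rint measurable_snd pi_snd).
- exact/(image_intg measurable_fst pi_fst (intg_meas fi)).
- exact/(image_intg measurable_snd pi_snd (intg_meas gi)).
Qed.

Lemma pairing_intg f g : intg mu f -> intg nu g ->
  intg P (fun z => (f z.1 + g z.2) * Z z)%R.
Proof.
move=> fi gi; have hi := coupling_sum_intg fi gi.
exact/(dens_intg Zi piZ (intg_meas hi)).
Qed.

Lemma pairing_Rint f g : intg mu f -> intg nu g ->
  (\int[P]_z ((f z.1 + g z.2) * Z z) = \int[mu]_x f x + \int[nu]_y g y)%R.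
Proof.
move=> fi gi; rewrite -coupling_sum_Rint//.
exact: (dens_Rint Zi piZ (coupling_sum_intg fi gi)).
Qed.

End marginals.

Definition primal_val Z : R :=
  (\int[P]_z (c z * Z z) + 2^-1 * \int[P]_z (Z z ^+ 2))%R.

Definition dual_val f g : R :=
  (\int[mu]_x f x + \int[nu]_y g y - 2^-1 * \int[P]_z (pospart f g c z ^+ 2))%R.

Lemma primal_costE Z : Z \in Lfun P 2%:E ->
  primal_cost tmu tnu c Z = (primal_val Z)%:E.
Proof.
move=> /L2P[mZ Z2]; rewrite /primal_cost sqnormE -EFin_Rint//.
  by rewrite -EFin_Rint// -EFinM -EFinD.
by apply: sq_intgM => //; [exact: cost_meas|exact: cost_sq_intg].
Qed.

Lemma dual_objectiveE f g : intg mu f -> intg nu g ->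
  intg P (fun z => pospart f g c z ^+ 2)%R ->
  dual_objective mu nu tmu tnu c f g = (dual_val f g)%:E.
Proof.
by move=> fi gi hi; rewrite /dual_objective -!EFin_Rint.
Qed.

Lemma dual_objective_fin f g : intg mu f -> intg nu g ->
  dual_objective mu nu tmu tnu c f g != -oo ->
  intg P (fun z => pospart f g c z ^+ 2)%R.
Proof.
move=> fi gi; apply: contra_neqP => nhi; rewrite /dual_objective.
rewrite -(EFin_Rint fi) -(EFin_Rint gi).
have mp := pospart_meas (intg_meas fi) (intg_meas gi).
have -> : \int[P]_z (pospart f g c z ^+ 2)%:E = +oo.
  apply/eqP; rewrite eq_le leey/= leNgt; apply/negP => hoo; apply: nhi.
  by apply: intg_lty => //; [meas|move=> z; exact: sqr_ge0].
by rewrite gt0_muley// lte_fin invr_gt0.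
Qed.

Definition gap Z f g (z : X * Y) : R :=
  (2^-1 * (Z z ^+ 2) + 2^-1 * (pospart f g c z ^+ 2)
    - (f z.1 + g z.2 - c z) * Z z)%R.

(** The difference of the two sides is [(p - h) Z], with [p - h = h_-]. *)
Lemma gap_ge Z f g z : (0 <= Z z)%R ->
  (2^-1 * ((Z z - pospart f g c z) ^+ 2) <= gap Z f g z)%R.
Proof. by move=> Z0; have := pospart_ge f g z; rewrite /gap; nra. Qed.

Lemma gap_ge0 Z f g z : (0 <= Z z)%R -> (0 <= gap Z f g z)%R.
Proof.
move=> Z0; apply: le_trans (gap_ge f g Z0).
by rewrite mulr_ge0// ?sqr_ge0// invr_ge0.
Qed.

(** The linear terms of the two problems cancel against each other, because
    [f (+) g] integrates against [Z dP] to [int f dmu + int g dnu]. *)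
Lemma gap_Rint Z f g : admissible mu nu tmu tnu Z ->
  intg mu f -> intg nu g -> intg P (fun z => pospart f g c z ^+ 2)%R ->
  intg P (gap Z f g) /\ (\int[P]_z gap Z f g z = primal_val Z - dual_val f g)%R.
Proof.
move=> [/L2P[mZ Z2] [pi pic piZ]] fi gi p2.
have mp := pospart_meas (intg_meas fi) (intg_meas gi).
have Zi := sq_intg mZ Z2.
have mc := cost_meas; have c2 := cost_sq_intg.
have fgZ := pairing_intg pic Zi piZ fi gi.
have cZ := sq_intgM mc mZ c2 Z2.
have hZ : intg P (fun z => (f z.1 + g z.2) * Z z - c z * Z z)%R by exact: intgB.
have Zp : intg P (fun z => 2^-1 * (Z z ^+ 2) + 2^-1 * (pospart f g c z ^+ 2))%R.
  by apply: intgD; exact: intgZ.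
have -> : gap Z f g = (fun z =>
  2^-1 * (Z z ^+ 2) + 2^-1 * (pospart f g c z ^+ 2)
    - ((f z.1 + g z.2) * Z z - c z * Z z))%R.
  by apply/funext => z; rewrite /gap; ring.
split; first exact: intgB.
rewrite RintegralB// RintegralB// RintegralD//; [|exact: intgZ..].
rewrite !RintegralZl// (pairing_Rint pic Zi piZ fi gi) /primal_val /dual_val.
lra.
Qed.

Lemma duality_gap Z f g : admissible mu nu tmu tnu Z ->
  intg mu f -> intg nu g -> intg P (fun z => pospart f g c z ^+ 2)%R ->
  (dual_val f g + 2^-1 * \int[P]_z ((Z z - pospart f g c z) ^+ 2) <= primal_val
    Z)%R.
Proof.
move=> adm fi gi p2; have [gapi gapE] := gap_Rint adm fi gi p2.
have [/L2P[mZ Z2] [pi pic piZ]] := adm; have Zi := sq_intg mZ Z2.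
have mp := pospart_meas (intg_meas fi) (intg_meas gi).
have Zp2 : intg P (fun z => (Z z - pospart f g c z) ^+ 2)%R.
  exact: sq_intgB.
rewrite -lerBrDl -gapE -RintegralZl//; apply: ae_le_Rint => //.
  exact: intgZ.
by apply: filterS (dens_ge0 Zi piZ) => z Z0; exact: gap_ge.
Qed.

Lemma gap_eq f g : admissible mu nu tmu tnu (pospart f g c) ->
  intg mu f -> intg nu g -> primal_val (pospart f g c) = dual_val f g.
Proof.
move=> [/L2P[mp p2] [pi pic pip]] fi gi.
have pint := sq_intg mp p2.
have mc := cost_meas; have c2 := cost_sq_intg.
have fgp := pairing_intg pic pint pip fi gi.
have cp := sq_intgM mc mp c2 p2.
have e : (\int[P]_z (pospart f g c z ^+ 2) =
   \int[P]_z ((f z.1 + g z.2) * pospart f g c z - c z * pospart f g c z))%R.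
  apply: eq_Rintegral => z _.
  by case: (pospart_cases f g z) => ->; ring.
move: e; rewrite RintegralB//
  (pairing_Rint pic pint pip fi gi) /primal_val /dual_val.
lra.
Qed.

End duality.

(** * Existence of a dual maximiser *)

Section density_facts.
Context d (T : measurableType d) (R : realType) (m r : probability T R).
Hypotheses (mr : m `<< r) (rm : r `<< m).

Lemma rn_density_sq_intg : density m r \in Lfun r 2%:E ->
  intg r (fun x => rn_density m r x ^+ 2)%R.
Proof.
move=> /L2P[_ d2]; have ma := intg_meas (rn_density_intg mr).
apply: ae_intg d2; first by meas.
by apply: filterS (rn_densityE mr) => x e /e ->.
Qed.

(** By equivalence of the measures the density vanishes only on a null set, so
    that the value [0^-1 = 0] does not weaken the bound on the inverse. *)
Lemma rn_density_lower_bound : (fun x => (density m r x)^-1)%R \in Lfun r +oo ->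
  exists2 delta : R, (0 < delta)%R & \forall x \ae r,
    (delta <= rn_density m r x)%R.
Proof.
rewrite inE => /andP[_]; rewrite inE/= /finite_norm unlock /Lnorm.
rewrite [X in if 0 < X then _ else _](@probability_setT _ _ _ r) lte01 =>
  /ess_supr_bounded[K aeK].
have mr0 : measurable_fun setT (rn_density m r) :=
  intg_meas (rn_density_intg mr).
pose N := rn_density m r @^-1` [set 0%R].
have mN : measurable N by rewrite -[N]setTI; exact: mr0.
have N0 : m N = 0.
  rewrite (rn_density_integral mr)//; apply: integral0_eq => x /= ->.
  by [].
have rN0 : r N = 0 by move/null_content_dominatesP : rm; apply.
exists (`|K| + 1)^-1%R; first by rewrite invr_gt0 ltr_wpDl.
have aeN : \forall x \ae r, ~ N x by exists N; split => // x /contrapT.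
apply: filterS3 (rn_densityE mr) aeK aeN => x /(_ I) <- Kx Nx.
have x0 : (0 < rn_density m r x)%R.
  by rewrite lt_neqAle rn_density_ge0// andbT eq_sym; apply/eqP.
rewrite -[leRHS]invrK lef_pV2 ?posrE ?invr_gt0 ?ltr_wpDl//.
have : (`|(rn_density m r x)^-1| <= K)%R by exact: Kx.
move=> /ler_normlW /le_trans; apply.
by rewrite (le_trans (ler_norm K))// lerDl.
Qed.

End density_facts.

Section attainment.
Context (R : realType) d1 d2 (X : measurableType d1) (Y : measurableType d2).
Variables (mu tmu : probability X R) (nu tnu : probability Y R).
Variable c : X * Y -> R.
Hypothesis SA : standing_assumptions mu nu tmu tnu c.
Notation P := (refm tmu tnu).
Notation dual := (dual_val mu tmu nu tnu c).
Notation primal := (primal_val tmu tnu c).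
Let Z0 := product_density mu tmu nu tnu.

Let mutmu : mu `<< tmu. Proof. exact: (equiv_mu SA).1. Qed.
Let nutnu : nu `<< tnu. Proof. exact: (equiv_nu SA).1. Qed.

Definition dual_pair (f : X -> R) (g : Y -> R) :=
  [/\ intg mu f, intg nu g & intg P (fun z => pospart f g c z ^+ 2)%R].

Lemma product_density_ge0 z : (0 <= Z0 z)%R.
Proof. by rewrite mulr_ge0// rn_density_ge0. Qed.

Lemma product_coupling : coupling mu nu (refm mu nu).
Proof. by split=> A mA; [exact: refm_fst|exact: refm_snd]. Qed.

(** The density of the independent coupling is almost everywhere positive, so
    that the gap relative to it controls [f (+) g] on the whole product. *)
Lemma product_admissible : admissible mu nu tmu tnu Z0.
Proof.
split; last first.
  exists (refm mu nu); first exact: product_coupling.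
  exact: product_has_density.
apply/L2P; split.
  have ma := intg_meas (rn_density_intg mutmu);
    have mb := intg_meas (rn_density_intg nutnu).
  by rewrite /Z0 /product_density; meas.
have a2 := rn_density_sq_intg mutmu (density_mu_L2 SA).
have b2 := rn_density_sq_intg nutnu (density_nu_L2 SA).
rewrite (_ : (fun _ => _) = (fun z : X * Y =>
    rn_density mu tmu z.1 ^+ 2 * rn_density nu tnu z.2 ^+ 2)%R).
  exact: (intg_prod a2 b2).
by apply/funext => z; rewrite exprMn.
Qed.

Let Z0_meas : measurable_fun setT Z0.
Proof. by have [/L2P[]] := product_admissible. Qed.

Let Z0_sq : intg P (fun z => Z0 z ^+ 2)%R.
Proof. by have [/L2P[]] := product_admissible. Qed.

Let Z0_intg : intg P Z0. Proof. exact: sq_intg. Qed.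

Let Z0_dens : has_density tmu tnu (refm mu nu) Z0.
Proof. exact: product_has_density. Qed.

Lemma dual_pair0 : dual_pair (cst 0%R) (cst 0%R).
Proof.
split; [exact: intg_cst|exact: intg_cst|].
apply: intg_le (cost_sq_intg SA) _.
  by apply: measurable_funX; apply: (pospart_meas SA); exact: measurable_cst.
move=> z; rewrite ger0_norm ?sqr_ge0// /pospart addr0 sub0r.
by rewrite maxEle; case: ifP => _; rewrite ?sqrrN// expr0n sqr_ge0.
Qed.

(** The positive part is convex, hence the dual functional is concave. *)
Lemma dual_concave f1 g1 f2 g2 : dual_pair f1 g1 -> dual_pair f2 g2 ->
  dual_pair (fun x => (f1 x + f2 x) / 2)%R (fun y => (g1 y + g2 y) / 2)%R /\
  ((dual f1 g1 + dual f2 g2) / 2 <=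
    dual (fun x => (f1 x + f2 x) / 2) (fun y => (g1 y + g2 y) / 2))%R.
Proof.
move=> [f1i g1i p1] [f2i g2i p2].
pose f x := ((f1 x + f2 x) / 2)%R; pose g y := ((g1 y + g2 y) / 2)%R.
have half d (T : measurableType d) (m : probability T R) (u v : T -> R) :
    intg m u -> intg m v -> intg m (fun x => (u x + v x) / 2)%R /\
    (\int[m]_x ((u x + v x) / 2) = (\int[m]_x u x + \int[m]_x v x) / 2)%R.
  move=> ui vi; have uvi := intgD ui vi; split.
    under eq_fun do rewrite mulrC.
    exact: intgZ.
  by rewrite RintegralZr// RintegralD.
have [fi fE] := half _ _ _ _ _ f1i f2i; have [gi gE] := half _ _ _ _ _ g1i g2i.
have [pi pE] := half _ _ _ _ _ p1 p2.
have mp : measurable_fun setT (pospart f g c).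
  exact: (pospart_meas SA (intg_meas fi) (intg_meas gi)).
have ple z : (pospart f g c z ^+ 2 <=
    (pospart f1 g1 c z ^+ 2 + pospart f2 g2 c z ^+ 2) / 2)%R.
  have := pospart_ge0 c f1 g1 z; have := pospart_ge0 c f2 g2 z.
  have := pospart_ge c f1 g1 z; have := pospart_ge c f2 g2 z.
  set q1 := pospart f1 g1 c z; set q2 := pospart f2 g2 c z.
  move=> h2 h1 q20 q10; have p0 := pospart_ge0 c f g z.
  have : (pospart f g c z <= (q1 + q2) / 2)%R.
    by have [->|->] := pospart_cases c f g z; rewrite /f /g; lra.
  have := sqr_ge0 (q1 - q2); nra.
have fgp : intg P (fun z => pospart f g c z ^+ 2)%R.
  apply: intg_le pi _; first by meas.
  by move=> z; rewrite ger0_norm ?sqr_ge0.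
split; first by split.
have := le_Rintegral measurableT fgp pi (fun z _ => ple z).
rewrite pE /dual_val fE gE; lra.
Qed.

(** Coercivity: [|h| <= 2 p - h], and [2 p Z0 <= p^2 / 2 + 2 Z0^2] is absorbed
    by the gap. *)
Let lower_bound (f : X -> R) (g : Y -> R) z :
  (`|f z.1 + g z.2| * Z0 z <= `|c z * Z0 z| + gap c Z0 f g z + 2 * Z0 z ^+ 2)%R.
Proof.
have z0 := product_density_ge0 z.
rewrite normrM (ger0_norm z0) /gap.
have := pospart_ge0 c f g z; have := pospart_ge c f g z.
set p := pospart f g c z => hp p0.
have : (`|f z.1 + g z.2| <= `|c z| + (2 * p - (f z.1 + g z.2 - c z)))%R.
  have := ler_norm (c z); have := ler_norm (- c z)%R; rewrite normrN.
  by rewrite ler_norml; move=> *; apply/andP; split; lra.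
move=> /(ler_wpM2r z0); have := sqr_ge0 (2 * Z0 z - p)%R; nra.
Qed.

(** A section of [f (+) g] differs from [f] or from [g] by a constant. *)
Lemma intg_sum_split (f : X -> R) (g : Y -> R) :
  intg (refm mu nu) (fun z => f z.1 + g z.2)%R ->
  measurable_fun setT f -> measurable_fun setT g -> intg mu f /\ intg nu g.
Proof.
move=> fgi mf mg; split.
- have [y fy] := ae_witness (ae_integrable2 fgi).
  apply: ae_intg (intgB fy (intg_cst mu (g y))) => //.
  by apply: aeW => x _ /=; rewrite addrK.
- have [x fx] := ae_witness (ae_integrable1 fgi).
  apply: ae_intg (intgB fx (intg_cst nu (f x))) => //.
  by apply: aeW => y _ /=; rewrite addrC addKr.
Qed.

Let value : set R := [set dual fg.1 fg.2 | fg in [set fg | dual_pair fg.1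
  fg.2]].

Let has_sup_value : has_sup value.
Proof.
split; first by exists (dual (cst 0%R) (cst 0%R)), (cst 0%R, cst 0%R) => //;
  exact: dual_pair0.
exists (primal Z0) => _ [[f g] [/= fi gi p2] <-].
have := duality_gap SA product_admissible fi gi p2; apply: le_trans.
by rewrite lerDl mulr_ge0 ?invr_ge0// Rintegral_ge0// => z _; exact: sqr_ge0.
Qed.

Let ell := sup value.

Let le_ell f g : dual_pair f g -> (dual f g <= ell)%R.
Proof. by move=> fg; apply: sup_ubound (has_sup_value.2) _ _;
  exists (f, g). Qed.

Let level n : set (X * Y -> R) := [set h | exists f g, [/\ dual_pair f g,
  (ell - n.+1%:R^-1 <= dual f g)%R & h = (fun z => f z.1 + g z.2)%R]].

Let level_intg n h : level n h -> intg (refm mu nu) h.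
Proof.
move=> [f [g [[fi gi _] _ ->]]].
exact: (coupling_sum_intg product_coupling).
Qed.

Let M : R :=
  (\int[P]_z (`|c z * Z0 z|) + (primal Z0 - ell + 1) + 2 * \int[P]_z (Z0 z ^+
    2))%R.

Let cZ0 : intg P (fun z => c z * Z0 z)%R.
Proof. by apply: sq_intgM => //;
  [exact: cost_meas SA|exact: cost_sq_intg SA]. Qed.

Let level_bounded n h : level n h -> (\int[refm mu nu]_z `|h z| <= M)%R.
Proof.
move=> lh; have hi := level_intg lh.
move: lh => [f [g [[fi gi p2] dl hE]]].
have [gapi gapE] := gap_Rint SA product_admissible fi gi p2.
rewrite -(dens_Rint Z0_intg Z0_dens (intg_abs hi)).
apply: (@le_trans _ _
    (\int[P]_z (`|c z * Z0 z| + gap c Z0 f g z + 2 * Z0 z ^+ 2)))%R.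
  apply: le_Rintegral => //.
  - exact/(dens_intg Z0_intg Z0_dens (intg_meas (intg_abs hi)))/intg_abs.
  - by apply: intgD; [apply: intgD => //; exact: intg_abs|exact: intgZ].
  - by move=> z _; rewrite hE; exact: lower_bound.
rewrite RintegralD//; [|by apply: intgD => //; exact: intg_abs|exact: intgZ].
rewrite RintegralD//; last exact: intg_abs.
rewrite RintegralZl// gapE /M lerD2r lerD2l.
have : (n.+1%:R^-1 <= 1 :> R)%R by rewrite invf_le1// ler1n.
by move: dl; set e := _^-1%R; lra.
Qed.

Let level_neq0 n : level n !=set0.
Proof.
have [|_ [[f g] /= fg <-] lt] :=
  @sup_adherent _ value (n.+1%:R^-1) _ has_sup_value.
  by rewrite invr_gt0.
by exists (fun z => f z.1 + g z.2)%R, f, g; split => //; exact: ltW.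
Qed.

Let level_decr n k : (n <= k)%N -> level k `<=` level n.
Proof.
move=> nk h [f [g [fg dl hE]]]; exists f, g; split => //.
apply: le_trans dl; rewrite lerD2l lerN2 lef_pV2 ?posrE//.
by rewrite ler_nat.
Qed.

Let level_mid n h1 h2 : level n h1 -> level n h2 ->
  level n (fun z => (h1 z + h2 z) / 2)%R.
Proof.
move=> [f1 [g1 [fg1 dl1 ->]]] [f2 [g2 [fg2 dl2 ->]]].
have [fg dfg] := dual_concave fg1 fg2.
exists (fun x => (f1 x + f2 x) / 2)%R, (fun y => (g1 y + g2 y) / 2)%R;
  split=> //.
  by move: dl1 dl2 dfg; set e := n.+1%:R^-1%R; lra.
by apply/funext => z /=; field.
Qed.

(** A maximising sequence can be chosen almost everywhere convergent by
    convexity, and the duality gap relative to the independent coupling, being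
    the integral of a nonnegative function, is lower semicontinuous. *)
Lemma dual_attained : exists f g, dual_pair f g /\
  forall f' g', dual_pair f' g' -> (dual f' g' <= dual f g)%R.
Proof.
have [h [lh hc]] := convex_ae_cvg level_intg level_bounded level_neq0
  level_decr level_mid.
have /choice[fg fgP] k : exists fg : (X -> R) * (Y -> R),
    [/\ dual_pair fg.1 fg.2, (ell - k.+1%:R^-1 <= dual fg.1 fg.2)%R
      & h k = (fun z => fg.1 z.1 + fg.2 z.2)%R].
  by have [f [g fgk]] := lh k; exists (f, g).
have mf k : measurable_fun setT (fg k).1.
  by have [[fi _ _] _ _] := fgP k; exact: intg_meas fi.
have mg k : measurable_fun setT (fg k).2.
  by have [[_ gi _] _ _] := fgP k; exact: intg_meas gi.
have hc' : \forall z \ae refm mu nu,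
    cvgn (fun k => (fg k).1 z.1 + (fg k).2 z.2)%R.
  apply: filterS hc => z; rewrite (_ : h^~ z =
      (fun k => (fg k).1 z.1 + (fg k).2 z.2)%R)//.
  by apply/funext => k; have [_ _ ->] := fgP k.
(* Replacing [(f_k, g_k)] by [(f_k + r_k, g_k - r_k)] changes neither
   [f_k (+) g_k] nor the gap. *)
have [r [f0 [g0 [mf0 mg0 ff0 gg0]]]] := ae_cvg_split mf mg hc'.
have sumcvg : \forall z \ae P,
    (fun k => (fg k).1 z.1 + (fg k).2 z.2)%R @ \oo --> (f0 z.1 + g0 z.2)%R.
  have F1 : \forall x \ae tmu, (fun k => (fg k).1 x + r k)%R @ \oo --> f0 x.
    exact: (null_dominates_ae (equiv_mu SA).2 ff0).
  have G1 : \forall y \ae tnu, (fun k => (fg k).2 y - r k)%R @ \oo --> g0 y.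
    exact: (null_dominates_ae (equiv_nu SA).2 gg0).
  have := image_ae measurable_fst (@refm_fst _ _ _ _ _ tmu tnu) F1.
  have := image_ae measurable_snd (@refm_snd _ _ _ _ _ tmu tnu) G1.
  apply: filterS2 => z gz fz.
  rewrite (_ : (fun _ => _) =
    (fun k => ((fg k).1 z.1 + r k) + ((fg k).2 z.2 - r k))%R).
    exact: cvgD fz gz.
  by apply/funext => k; ring.
have mgap f g : measurable_fun setT f -> measurable_fun setT g ->
    measurable_fun setT (gap c Z0 f g).
  move=> mf' mg'; have mp := pospart_meas SA mf' mg'; have mc := cost_meas SA.
  by rewrite /gap; meas.
have gapcvg : \forall z \ae P,
    (fun k => gap c Z0 (fg k).1 (fg k).2 z) @ \oo --> gap c Z0 f0 g0 z.
  apply: filterS sumcvg => z sz.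
  have hz : (fun k => (fg k).1 z.1 + (fg k).2 z.2 - c z)%R @ \oo -->
      (f0 z.1 + g0 z.2 - c z)%R by apply: cvgB => //; exact: cvg_cst.
  have pE f g : pospart f g c z =
      ((f z.1 + g z.2 - c z + `|f z.1 + g z.2 - c z|) / 2)%R.
    rewrite /pospart maxEle; case: ifP => h0;
      first by rewrite ler0_norm// subrr mul0r.
    rewrite ger0_norm; first by field.
    by rewrite ltW// ltNge h0.
  rewrite /gap; under eq_fun do rewrite pE.
  rewrite pE; apply: cvgB; last by apply: cvgM => //; exact: cvg_cst.
  apply: cvgD; first exact: cvg_cst.
  apply: cvgM; first exact: cvg_cst.
  rewrite expr2; under eq_fun do rewrite expr2.
  have hp : (fun k => ((fg k).1 z.1 + (fg k).2 z.2 - c z +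
      `|(fg k).1 z.1 + (fg k).2 z.2 - c z|) / 2)%R @ \oo -->
      ((f0 z.1 + g0 z.2 - c z + `|f0 z.1 + g0 z.2 - c z|) / 2)%R.
    apply: cvgM; last exact: cvg_cst.
    by apply: cvgD => //; exact: cvg_norm.
  exact: cvgM.
have gapbound : \int[P]_z (gap c Z0 f0 g0 z)%:E <= (primal Z0 - ell)%:E.
  apply: (fatou_bound (F := fun k => gap c Z0 (fg k).1 (fg k).2)
     (C := fun k => (primal Z0 - ell + k.+1%:R^-1)%R)) gapcvg => //.
  - by move=> k; exact: mgap.
  - by move=> k z; apply: gap_ge0; exact: product_density_ge0.
  - exact: mgap.
  - by move=> z; apply: gap_ge0; exact: product_density_ge0.
  - move=> k; have [[fi gi p2] dl _] := fgP k.
    have [gapi gapE] := gap_Rint SA product_admissible fi gi p2.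
    rewrite -EFin_Rint// gapE lee_fin; move: dl.
    by set e := k.+1%:R^-1%R; lra.
  - rewrite -[X in _ --> X]addr0; apply: cvgD; first exact: cvg_cst.
    exact: cvg_harmonic.
have gapi : intg P (gap c Z0 f0 g0).
  apply: intg_lty; first exact: mgap.
    by move=> z; apply: gap_ge0; exact: product_density_ge0.
  by rewrite (le_lt_trans gapbound)// ltry.
have msum : measurable_fun setT (fun z : X * Y => f0 z.1 + g0 z.2)%R by meas.
have [f0i g0i] : intg mu f0 /\ intg nu g0.
  apply: intg_sum_split => //.
  apply/(dens_intg Z0_intg Z0_dens msum).
  apply: (intg_le (g := fun z =>
      (`|c z * Z0 z| + gap c Z0 f0 g0 z + 2 * Z0 z ^+ 2)%R)).
  - by meas.
  - by apply: intgD; [apply: intgD => //; exact: intg_abs|exact: intgZ].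
  - move=> z; rewrite normrM (ger0_norm (product_density_ge0 z)).
    exact: lower_bound.
have p0i : intg P (fun z => pospart f0 g0 c z ^+ 2)%R.
  have mp := pospart_meas SA mf0 mg0.
  apply: (intg_le (g := fun z => (4 * gap c Z0 f0 g0 z + 2 * Z0 z ^+ 2)%R)).
  - by meas.
  - by apply: intgD; exact: intgZ.
  - move=> z; rewrite ger0_norm ?sqr_ge0//.
    have := gap_ge c f0 g0 (product_density_ge0 z).
    by have := sqr_ge0 (2 * Z0 z - pospart f0 g0 c z)%R; nra.
exists f0, g0; split=> // f' g' fg'.
apply: le_trans (le_ell fg') _.
have [_ gapE] := gap_Rint SA product_admissible f0i g0i p0i.
move: gapbound; rewrite -EFin_Rint// gapE lee_fin; lra.
Qed.

End attainment.

(** * Couplings given by a density *)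

Section density_measure.
Context d (T : measurableType d) (R : realType) (r : probability T R).
Variable p : T -> R.
Hypotheses (pi : intg r p) (p0 : forall x, (0 <= p x)%R)
  (p1 : \int[r]_x (p x)%:E = 1).

Definition density_measure (A : set T) : \bar R := \int[r]_(x in A) (p x)%:E.

Let density_measure0 : density_measure set0 = 0.
Proof. by rewrite /density_measure integral_set0. Qed.

Let density_measure_ge0 A : 0 <= density_measure A.
Proof. by apply: integral_ge0 => x _; rewrite lee_fin. Qed.

Let density_measure_sigma_additive : semi_sigma_additive density_measure.
Proof.
move=> F mF tF mUF; rewrite /density_measure integral_bigcup//; last first.
  exact: (integrableS measurableT).
apply: is_cvg_ereal_nneg_natsum_cond => n _ _.
by apply: integral_ge0 => x _; rewrite lee_fin.
Qed.

HB.instance Definition _ := isMeasure.Build _ _ _ density_measure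
  density_measure0 density_measure_ge0 density_measure_sigma_additive.

HB.instance Definition _ :=
  @Measure_isProbability.Build _ _ R density_measure p1.

Lemma density_probability : exists m : probability T R,
  forall A, measurable A -> m A = \int[r]_(x in A) (p x)%:E.
Proof. by exists density_measure. Qed.

End density_measure.

Section swap.
Context (R : realType) d1 d2 (X : measurableType d1) (Y : measurableType d2).

Definition swap_fun (F : X * Y -> R) : Y * X -> R := fun z => F (z.2, z.1).

Lemma refm_swap (mu : probability X R) (nu : probability Y R) :
  measure_image (fun z : Y * X => (z.2, z.1)) (refm nu mu) (refm mu nu).
Proof.
move=> A mA.
have mI : measurable_fun setT (\1_A : X * Y -> R) by exact: measurable_indic.
have mswap : measurable_fun setT (fun z : Y * X => (z.2, z.1)).
  by apply: measurable_fun_pair; [exact: measurable_snd|exact: measurable_fst].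
have mIs : measurable_fun setT (fun z : Y * X => \1_A (z.2, z.1) : R).
  exact: (measurableT_comp mI mswap).
have mA' : measurable ((fun z : Y * X => (z.2, z.1)) @^-1` A).
  by rewrite -[X in measurable X]setTI; exact: mswap.
have -> : refm mu nu A = \int[refm mu nu]_z (\1_A z)%:E.
  by rewrite integral_indic// setIT.
have -> : refm nu mu ((fun z : Y * X => (z.2, z.1)) @^-1` A) =
    \int[refm nu mu]_z (\1_A (z.2, z.1))%:E.
  by rewrite -[LHS](congr1 _ (setIT _)) -integral_indic.
rewrite refm_tonelli2// refm_tonelli1//.
Qed.

Lemma measurable_swap :
  measurable_fun setT (fun z : Y * X => (z.2, z.1)).
Proof. by apply: measurable_fun_pair;
  [exact: measurable_snd|exact: measurable_fst]. Qed.

Lemma pospart_swap (f : X -> R) (g : Y -> R) c z :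
  pospart g f (swap_fun c) z = pospart f g c (z.2, z.1).
Proof. by rewrite /pospart /swap_fun /= [(g _ + _)%R]addrC. Qed.

Lemma standing_swap (mu tmu : probability X R) (nu tnu : probability Y R) c :
  standing_assumptions mu nu tmu tnu c ->
  standing_assumptions nu mu tnu tmu (swap_fun c).
Proof.
move=> SA; split; try by case: SA.
- have mc := cost_meas SA; have c2 := cost_sq_intg SA.
  apply/L2P; split; first exact: (measurableT_comp mc measurable_swap).
  apply/(image_intg measurable_swap (@refm_swap tmu tnu)
    (F := fun z => (c z ^+ 2)%R)) => //.
  by meas.
- have [c1 [c2 [? ? ? ? cle]]] := cost_lower_bound SA.
  by exists c2, c1; split => // y x; rewrite addrC; exact: cle.
Qed.

Lemma potential_system_swap (mu tmu : probability X R) (nu tnu : probability Y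
  R)
    c f g : potential_system mu nu tmu tnu c f g ->
  potential_system nu mu tnu tmu (swap_fun c) g f.
Proof.
move=> [sy sx]; split.
- apply: filterS sx => x <-; apply: eq_integral => y _.
  by rewrite pospart_swap.
- apply: filterS sy => y <-; apply: eq_integral => x _.
  by rewrite pospart_swap.
Qed.

End swap.

Lemma integral_preimage_indic (R : realType) d d' (T : measurableType d)
    (T' : measurableType d') (m : {measure set T -> \bar R}) (phi : T -> T')
    (A : set T') (p : T -> R) :
  \int[m]_(z in phi @^-1` A) (p z)%:E = \int[m]_z (\1_A (phi z) * p z)%:E.
Proof.
rewrite integral_mkcond; apply: eq_integral => z _; rewrite patchE indicE.
case: ifPn => zA; first by rewrite (_ : phi z \in A) ?mul1r// inE;
  rewrite inE in zA.
rewrite (_ : phi z \in A = false) ?mul0r//.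
by apply/negbTE; rewrite notin_setE; rewrite notin_setE in zA.
Qed.

Section sections_and_marginals.
Context (R : realType) d1 d2 (X : measurableType d1) (Y : measurableType d2).

Lemma first_marginal_sections (mu tmu : probability X R) (tnu : probability Y R)
    (p : X * Y -> R) : mu `<< tmu ->
  measurable_fun setT p -> (forall z, 0 <= p z)%R ->
  (forall A, measurable A -> \int[refm tmu tnu]_(z in fst @^-1` A) (p z)%:E =
    mu A)
  <-> \forall x \ae tmu, \int[tnu]_y (p (x, y))%:E = (density mu tmu x)%:E.
Proof.
move=> mutmu mp p0.
have sectE A : measurable A ->
    \int[refm tmu tnu]_(z in fst @^-1` A) (p z)%:E =
    \int[tmu]_(x in A) \int[tnu]_y (p (x, y))%:E.
  move=> mA.
  have mI : measurable_fun setT (\1_A : X -> R) by exact: measurable_indic.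
  have I0 x : (0 <= \1_A x :> R)%R by rewrite indicE.
  rewrite integral_preimage_indic.
  rewrite refm_tonelli1//; [|by meas|by move=> z; rewrite mulr_ge0].
  rewrite [RHS]integral_mkcond; apply: eq_integral => x _; rewrite patchE.
  rewrite /= indicE; case: ifPn => xA.
    by apply: eq_integral => y _; rewrite mul1r.
  by under eq_integral => y _ do rewrite mul0r; rewrite integral0.
have mF := measurable_int1 tnu mp p0.
have F0 x : 0 <= \int[tnu]_y (p (x, y))%:E.
  by apply: integral_ge0 => y _; rewrite lee_fin.
have ai := rn_density_intg mutmu.
split=> [marg|sect].
- have aeE : ae_eq tmu setT (EFin \o rn_density mu tmu)
      (fun x => \int[tnu]_y (p (x, y))%:E).
    apply: integral_ae_eq => // A _ mA.
    by rewrite -sectE// marg// (rn_density_integral mutmu).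
  apply: filterS2 aeE (rn_densityE mutmu) => x /(_ I) <- /(_ I) e.
  by rewrite /= e.
- move=> A mA; rewrite sectE// (rn_density_integral mutmu mA).
  apply: ae_eq_integral => //.
  + exact: measurable_funTS.
  + exact/measurable_funTS/(measurable_int _ ai).
  + apply: filterS2 sect (rn_densityE mutmu) => x -> /(_ I) e _.
    by rewrite /= e.
Qed.

End sections_and_marginals.

Section second_marginal.
Context (R : realType) d1 d2 (X : measurableType d1) (Y : measurableType d2).

Lemma second_marginal_sections (tmu : probability X R) (nu tnu : probability Y
  R)
    (p : X * Y -> R) : nu `<< tnu ->
  measurable_fun setT p -> (forall z, 0 <= p z)%R ->
  (forall B, measurable B -> \int[refm tmu tnu]_(z in snd @^-1` B) (p z)%:E =
    nu B)
  <-> \forall y \ae tnu, \int[tmu]_x (p (x, y))%:E = (density nu tnu y)%:E.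
Proof.
move=> nutnu mp p0.
pose q : Y * X -> R := swap_fun p.
have mswap := @measurable_swap _ _ X Y.
have mq : measurable_fun setT q := measurableT_comp mp mswap.
have H := first_marginal_sections tmu nutnu mq (fun z => p0 (z.2, z.1)).
have e B : measurable B -> \int[refm tnu tmu]_(z in fst @^-1` B) (q z)%:E =
    \int[refm tmu tnu]_(z in snd @^-1` B) (p z)%:E.
  move=> mB; rewrite !integral_preimage_indic.
  have mI : measurable_fun setT (\1_B : Y -> R) by exact: measurable_indic.
  rewrite -(ge0_image_integral mswap (refm_swap tmu tnu)
    (F := fun z => (\1_B z.2 * p z)%R))//; first by meas.
  by move=> z; rewrite mulr_ge0// indicE.
apply: iff_trans H.
by split=> H' B mB; [rewrite e//|rewrite -e//]; exact: H'.
Qed.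

End second_marginal.

(** * First-order condition and integrability of potentials *)

Section ae_integrability.
Context d (T : measurableType d) (R : realType) (r : probability T R).

Lemma ae_intg_le (f g : T -> R) : measurable_fun setT f -> intg r g ->
  (\forall x \ae r, (`|f x| <= g x)%R) -> intg r f.
Proof.
move=> mf gi fg; have agi := intg_abs gi; have mag := intg_meas agi.
apply/integrableP; split; first exact/measurable_EFinP.
have /integrableP[_] := gi; apply: le_lt_trans.
apply: ae_ge0_le_integral => //.
- by apply/measurable_EFinP; meas.
- exact/measurable_EFinP.
- by apply: filterS fg => x fgx _; rewrite lee_fin (le_trans fgx)// ler_norm.
Qed.

Lemma lower_bounded_density_intg (m : probability T R) (delta : R) (F : T -> R)
  :
  m `<< r -> (0 < delta)%R -> (\forall x \ae r,
    (delta <= rn_density m r x)%R) ->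
  intg m F -> intg r F.
Proof.
move=> mr d0 dle Fi; have mF := intg_meas Fi.
have Fr : intg r (fun x => F x * rn_density m r x)%R.
  by apply/(dens_intg (rn_density_intg mr) (rn_density_integral mr)).
apply: (ae_intg_le (g := fun x => (delta^-1 * `|F x * rn_density m r x|)%R)) =>
  //.
  by apply: intgZ; exact: intg_abs.
apply: filterS dle => x dx.
rewrite ler_pdivlMl// normrM mulrC ler_wpM2l//.
by rewrite (le_trans dx)// ler_norm.
Qed.

Lemma small_tail (G : T -> R) (delta : R) : intg r G -> (0 < delta)%R ->
  exists n : nat, \int[r]_x (Num.max (G x - n%:R) 0)%:E < delta%:E.
Proof.
move=> Gi d0; have mG := intg_meas Gi.
pose F n x := Num.max (G x - n%:R)%R 0%R.
have mF n : measurable_fun setT (F n) by rewrite /F; meas.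
have F0 n x : (0 <= F n x)%R by rewrite le_max lexx orbT.
have FG n x : (F n x <= `|G x|)%R.
  by rewrite ge_max normr_ge0 andbT lerBlDr (le_trans (ler_norm _))// lerDl.
have Fi n : intg r (F n).
  apply: intg_le (intg_abs Gi) _ => // x; rewrite ger0_norm//; exact: FG.
have cF : (fun n => \int[r]_x F n x)%R @ \oo --> 0%R.
  have [] := @dominated_convergence _ _ _ r setT measurableT
    (fun n => EFin \o F n) (cst 0) (EFin \o (fun x => `|G x|)%R).
  - by move=> n; exact/measurable_EFinP.
  - exact: measurable_cst.
  - apply: aeW => x _; apply: cvg_near_cst.
    near=> n; congr EFin; apply/max_idPr; rewrite subr_le0.
    rewrite (le_trans (ler_norm _))//; near: n; exact: nbhs_infty_ger.
  - exact: intg_abs.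
  - by apply: aeW => x n _ /=; rewrite lee_fin ger0_norm.
  by move=> _ _; rewrite integral0 => /fine_cvg.
have [n _ Hn] := cvgr_lt _ cF _ d0.
by exists n; rewrite -(EFin_Rint (Fi n)) lte_fin; apply: Hn => /=.
Unshelve. all: by end_near.
Qed.

End ae_integrability.

Section potentials.
Context (R : realType) d1 d2 (X : measurableType d1) (Y : measurableType d2).
Variables (mu tmu : probability X R) (nu tnu : probability Y R).
Variable c : X * Y -> R.
Hypothesis SA : standing_assumptions mu nu tmu tnu c.
Notation P := (refm tmu tnu).
Notation dual := (dual_val mu tmu nu tnu c).
Notation primal := (primal_val tmu tnu c).
Notation dual_pair := (dual_pair mu tmu nu tnu c).

Let mutmu : mu `<< tmu. Proof. exact: (equiv_mu SA).1. Qed.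
Let nutnu : nu `<< tnu. Proof. exact: (equiv_nu SA).1. Qed.

Lemma marginals_coupling (p : X * Y -> R) :
  measurable_fun setT p -> (forall z, 0 <= p z)%R ->
  (forall A, measurable A -> \int[P]_(z in fst @^-1` A) (p z)%:E = mu A) ->
  (forall B, measurable B -> \int[P]_(z in snd @^-1` B) (p z)%:E = nu B) ->
  exists2 pi, coupling mu nu pi & has_density tmu tnu pi p.
Proof.
move=> mp p0 marg1 marg2.
have p1 : \int[P]_z (p z)%:E = 1.
  by rewrite -[setT](preimage_setT fst) marg1// probability_setT.
have pi : intg P p by apply: intg_lty => //; rewrite p1 ltry.
have [m mE] := density_probability pi p0 p1.
have mfst A : measurable A -> measurable (fst @^-1` A : set (X * Y)).
  by move=> mA; rewrite -[X in measurable X]setTI; exact: measurable_fst.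
have msnd A : measurable A -> measurable (snd @^-1` A : set (X * Y)).
  by move=> mA; rewrite -[X in measurable X]setTI; exact: measurable_snd.
exists m; last exact: mE.
split=> A mA.
- by rewrite mE ?marg1//; exact: mfst.
- by rewrite mE ?marg2//; exact: msnd.
Qed.

Lemma coupling_systemP f g :
  measurable_fun setT f -> measurable_fun setT g ->
  coupling_density mu nu tmu tnu c f g <-> potential_system mu nu tmu tnu c f g.
Proof.
move=> mf mg; have mp := pospart_meas SA mf mg; have p0 := pospart_ge0 c f g.
have sec1 := first_marginal_sections tnu mutmu mp p0.
have sec2 := second_marginal_sections tmu nutnu mp p0.
split=> [[m [m1 m2] mE]|[sy sx]].
- split.
  + apply/sec2 => B mB; rewrite -mE ?m2// -[X in measurable X]setTI.
    exact: measurable_snd.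
  + apply/sec1 => A mA; rewrite -mE ?m1// -[X in measurable X]setTI.
    exact: measurable_fst.
- apply: marginals_coupling => //; [exact/sec1|exact/sec2].
Qed.

(** Perturbing a maximiser by [eps] times an indicator in either variable, the
    bound [(h + e)_+^2 <= h_+^2 + 2 e h_+ + e^2] leaves the dual functional above
    a quadratic polynomial in [eps] with which it agrees at [eps = 0]; its
    linear coefficient, the defect of the marginal, must therefore vanish. *)
Lemma maximiser_coupling f g : dual_pair f g ->
  (forall f' g', dual_pair f' g' -> (dual f' g' <= dual f g)%R) ->
  coupling_density mu nu tmu tnu c f g.
Proof.
move=> [fi gi p2] fgmax.
have mf := intg_meas fi; have mg := intg_meas gi.
have mp := pospart_meas SA mf mg.
have p0 := pospart_ge0 c f g.
have pint := sq_intg mp p2.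
have main A B : measurable A -> measurable B ->
    intg P (fun z => (\1_A z.1 + \1_B z.2) * pospart f g c z)%R /\
    (\int[P]_z ((\1_A z.1 + \1_B z.2) * pospart f g c z) =
      \int[mu]_x (\1_A x) + \int[nu]_y (\1_B y))%R.
  move=> mA mB.
  have mIA : measurable_fun setT (\1_A : X -> R) by exact: measurable_indic.
  have mIB : measurable_fun setT (\1_B : Y -> R) by exact: measurable_indic.
  have Ai : intg mu (\1_A : X -> R).
    by apply: intg_le (intg_cst mu 1) _ => // x;
      rewrite indicE normr_nat lern1; case: (_ \in _).
  have Bi : intg nu (\1_B : Y -> R).
    by apply: intg_le (intg_cst nu 1) _ => // x;
      rewrite indicE normr_nat lern1; case: (_ \in _).
  pose w (z : X * Y) : R := (\1_A z.1 + \1_B z.2)%R.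
  have mw : measurable_fun setT w by rewrite /w; meas.
  have w0 z : (0 <= w z <= 2)%R.
    rewrite /w !indicE; case: (_ \in _); case: (_ \in _) => /=; apply/andP;
      split; lra.
  have w2 : intg P (fun z => w z ^+ 2)%R.
    apply: intg_le (intg_cst P 4) _; first by meas.
    by move=> z; rewrite ger0_norm ?sqr_ge0//; have /andP[] := w0 z; nra.
  have wp : intg P (fun z => w z * pospart f g c z)%R by exact: sq_intgM.
  pose K := (\int[mu]_x (\1_A x) + \int[nu]_y (\1_B y)
    - \int[P]_z (w z * pospart f g c z))%R.
  pose L := (\int[P]_z (w z ^+ 2))%R.
  have quad (e : R) : (e * K <= 2^-1 * e ^+ 2 * L)%R.
    pose f' x := (f x + e * \1_A x)%R; pose g' y := (g y + e * \1_B y)%R.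
    have f'i : intg mu f' by apply: intgD => //; exact: intgZ.
    have g'i : intg nu g' by apply: intgD => //; exact: intgZ.
    have mp' := pospart_meas SA (intg_meas f'i) (intg_meas g'i).
    have ple z : (pospart f' g' c z ^+ 2 <= pospart f g c z ^+ 2 +
        2 * e * (w z * pospart f g c z) + e ^+ 2 * w z ^+ 2)%R.
      have := p0 z; have := pospart_ge c f g z.
      have := pospart_ge0 c f' g' z.
      have : (pospart f' g' c z = f z.1 + g z.2 - c z + e * w z \/
          pospart f' g' c z = 0)%R.
        have [->|->] := pospart_cases c f' g' z; [left|by right].
        by rewrite /f' /g' /w; ring.
      set q := pospart f' g' c z; set p := pospart f g c z.
      case=> [qE q0 hp pp|-> _ _ _].
      + have : (q <= p + e * w z)%R by rewrite qE lerD2r.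
        by nra.
      + have := sqr_ge0 (p + e * w z)%R; nra.
    have ubi : intg P (fun z => pospart f g c z ^+ 2 +
        2 * e * (w z * pospart f g c z) + e ^+ 2 * w z ^+ 2)%R.
      by apply: intgD; [apply: intgD => //|]; exact: intgZ.
    have p'2 : intg P (fun z => pospart f' g' c z ^+ 2)%R.
      by apply: intg_le ubi _; [meas|move=> z; rewrite ger0_norm ?sqr_ge0].
    have := fgmax f' g' (And3 f'i g'i p'2).
    have := le_Rintegral measurableT p'2 ubi (fun z _ => ple z).
    rewrite RintegralD//; [|by apply: intgD => //; exact: intgZ|exact: intgZ].
    rewrite RintegralD//; last exact: intgZ.
    rewrite !RintegralZl//.
    rewrite /dual_val {3}/f' {3}/g' RintegralD//; last exact: intgZ.
    rewrite RintegralD//; last exact: intgZ.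
    rewrite !RintegralZl// /K /L; nra.
  have L0 : (0 <= L)%R by apply: Rintegral_ge0 => z _; exact: sqr_ge0.
  have L1 : (0 < L + 1)%R by lra.
  have K0 : K = 0%R.
    (* With [eps = K / (L + 1)] the linear term wins, unless [K = 0]. *)
    have := quad (K / (L + 1))%R.
    have KE : K = (K / (L + 1) * (L + 1))%R by rewrite divfK// gt_eqF.
    set s := (K / (L + 1))%R in KE *; rewrite KE => Ks.
    have : (s ^+ 2 * (2^-1 * L + 1) <= 0)%R by move: Ks; nra.
    rewrite pmulr_lle0; last by lra.
    have := sqr_ge0 s => s0 s1; have /eqP : (s ^+ 2 = 0)%R by lra.
    by rewrite sqrf_eq0 => /eqP ->; rewrite mul0r.
  split=> //; move: K0; rewrite /K /w; lra.
have iE d (T : measurableType d) (m : probability T R) (A : set T) :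
    measurable A -> intg m (\1_A : T -> R) /\
      (((\int[m]_x (\1_A x : R))%R)%:E = m A).
  move=> mA; have Ai : intg m (\1_A : T -> R).
    apply: intg_le (intg_cst m 1) _; first exact: measurable_indic.
    by move=> x; rewrite indicE normr_nat lern1; case: (_ \in _).
  by split=> //; rewrite EFin_Rint// integral_indic// setIT.
apply: marginals_coupling => // [A mA|B mB]; rewrite integral_preimage_indic.
- have [wi wE] := main A set0 mA measurable0.
  have e z : ((\1_A z.1 + \1_(set0 : set Y) z.2) * pospart f g c z =
      \1_A z.1 * pospart f g c z :> R)%R.
    by rewrite [\1_set0 _]indicE in_set0 addr0.
  have {}wi : intg P (fun z => \1_A z.1 * pospart f g c z)%R.
    by apply: eq_integrable wi => // z _ /=; rewrite e.
  rewrite -EFin_Rint//; have [_ <-] := iE _ _ mu A mA.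
  have [_ e0] := iE _ _ nu set0 measurable0.
  rewrite measure0 in e0; case: e0 => e0.
  congr EFin; rewrite -[RHS]addr0 -[X in (_ + X)%R]e0 -wE.
  by apply: eq_Rintegral => z _; rewrite e.
- have [wi wE] := main set0 B measurable0 mB.
  have e z : ((\1_(set0 : set X) z.1 + \1_B z.2) * pospart f g c z =
      \1_B z.2 * pospart f g c z :> R)%R.
    by rewrite [\1_set0 _]indicE in_set0 add0r.
  have {}wi : intg P (fun z => \1_B z.2 * pospart f g c z)%R.
    by apply: eq_integrable wi => // z _ /=; rewrite e.
  rewrite -EFin_Rint//; have [_ <-] := iE _ _ nu B mB.
  have [_ e0] := iE _ _ mu set0 measurable0.
  rewrite measure0 in e0; case: e0 => e0.
  congr EFin; rewrite -[RHS]add0r -[X in (X + _)%R]e0 -wE.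
  by apply: eq_Rintegral => z _; rewrite e.
Qed.

(** With the weight [w = (1 + |g|)^-1], bounded by 1, one has
    [f_+ w <= h_+ + 1 + |c|]. Multiplied by the density of [mu], the right side
    is integrable, because that density is square integrable and is itself the
    first marginal of [h_+]; a generic section in [y] then gives [f_+]. *)
Lemma potential_funrpos_intg f g :
  measurable_fun setT f -> measurable_fun setT g ->
  potential_system mu nu tmu tnu c f g -> intg mu (fun x => Num.max (f x) 0)%R.
Proof.
move=> mf mg [_ sx]; have mp := pospart_meas SA mf mg.
have p0 := pospart_ge0 c f g.
have mc := cost_meas SA; have c2 := cost_sq_intg SA.
have ai := rn_density_intg mutmu; have ma := intg_meas ai.
have a2 := rn_density_sq_intg mutmu (density_mu_L2 SA).
have a0 := rn_density_ge0 mutmu.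
pose a := rn_density mu tmu.
have api : intg P (fun z => a z.1 * pospart f g c z)%R.
  apply: intg_lty; [by meas|by move=> z; rewrite mulr_ge0|].
  rewrite refm_tonelli1//; [|by meas|by move=> z; rewrite mulr_ge0].
  rewrite (_ : \int[_]_x _ = \int[tmu]_x (a x ^+ 2)%:E).
    exact: (integrable_lty measurableT a2).
  have mF : measurable_fun setT
      (fun x => \int[tnu]_y (a x * pospart f g c (x, y))%:E).
    apply: (measurable_int1 tnu (F := fun z => (a z.1 * pospart f g c z)%R)).
      by meas.
    by move=> z; rewrite mulr_ge0.
  apply: ae_eq_integral => //; first by apply/measurable_EFinP; meas.
  apply: filterS2 sx (rn_densityE mutmu) => x px /(_ I) e _.
  have -> : \int[tnu]_y (a (x, y).1 * pospart f g c (x, y))%:E =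
      \int[tnu]_y ((a x)%:E * (pospart f g c (x, y))%:E).
    by apply: eq_integral => y _; rewrite EFinM.
  rewrite ge0_integralZl_EFin//; last 2 first.
  - by move=> y _; rewrite lee_fin.
  - apply/measurable_EFinP; exact: (measurableT_comp mp (pair1_measurable x)).
  by rewrite px -e -EFinM.
have aP : intg P (fun z => a z.1 ^+ 2)%R.
  apply/(image_intg measurable_fst (@refm_fst _ _ _ _ _ tmu tnu)
    (F := fun x => (a x ^+ 2)%R)) => //; by meas.
have maP : measurable_fun setT (fun z : X * Y => a z.1) by meas.
have aPi : intg P (fun z => a z.1) := sq_intg maP aP.
have aci : intg P (fun z => a z.1 * `|c z|)%R.
  apply: sq_intgM => //; first by meas.
  by under eq_fun do rewrite real_normK ?num_real//.
pose fp x := Num.max (f x) 0%R.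
pose w y : R := (1 + `|g y|)^-1%R.
have w1 y : (0 < w y <= 1)%R.
  by rewrite /w invr_gt0 invf_le1 ltr_wpDr// lerDl normr_ge0.
have mw : measurable_fun setT w.
  have ci : continuous (fun t : R => (1 + `|t|)^-1%R).
    move=> t; apply: cvgV; first by rewrite gt_eqF// ltr_wpDr.
    by apply: cvgD; [exact: cvg_cst|exact: norm_continuous].
  exact: (measurableT_comp (continuous_measurable_fun ci) mg).
have mfp : measurable_fun setT fp by rewrite /fp; meas.
have fwi : intg P (fun z => a z.1 * fp z.1 * w z.2)%R.
  apply: (intg_le (g := fun z => (a z.1 * pospart f g c z + a z.1 +
    a z.1 * `|c z|)%R)); first by meas.
    by apply: intgD => //; exact: intgD.
  move=> z; have /andP[w0 wle1] := w1 z.2.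
  have fp0 : (0 <= fp z.1)%R by rewrite le_max lexx orbT.
  rewrite ger0_norm; last by rewrite !mulr_ge0// ltW.
  rewrite -mulrA -[X in (_ + X + _)%R]mulr1 -!mulrDr ler_wpM2l//.
  have gw : (`|g z.2| * w z.2 <= 1)%R.
    by rewrite ler_pdivrMr ?mul1r ?lerDr// ltr_wpDr.
  have fle : (fp z.1 <= pospart f g c z + `|g z.2| + `|c z|)%R.
    rewrite ge_max; apply/andP; split; last by rewrite !addr_ge0.
    have := pospart_ge c f g z; have := ler_norm (- g z.2)%R; rewrite normrN.
    have := ler_norm (c z); lra.
  apply: (le_trans (ler_wpM2r (ltW w0) fle)).
  have := p0 z; have := normr_ge0 (c z); nra.
have [y fy] := ae_witness (ae_integrable2 fwi).
apply/(dens_intg ai (rn_density_integral mutmu)) => //.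
have /andP[w0 _] := w1 y.
apply: ae_intg (intgZ (w y)^-1 fy); first by meas.
by apply: aeW => x _ /=; rewrite mulrC mulfK ?gt_eqF// mulrC.
Qed.

(** If [f - c1] were very negative at [x], the section of [h_+] at [x] would be
    dominated by a far tail of [g_+ - c2], whose integral is smaller than the
    lower bound of the density of [mu]. *)
Lemma potential_intg f g :
  measurable_fun setT f -> measurable_fun setT g ->
  potential_system mu nu tmu tnu c f g ->
  intg nu (fun y => Num.max (g y) 0)%R -> intg mu f.
Proof.
move=> mf mg sys gpi.
have fpi := potential_funrpos_intg mf mg sys.
have [_ sx] := sys.
have [c1 [c2 [/L1P c1mu /L1P c1tmu /L1P c2nu /L1P c2tnu cge]]] :=
  cost_lower_bound SA.
have [da da0 ale] := rn_density_lower_bound mutmu (equiv_mu SA).2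
  (density_mu_inv_Loo SA).
have [db db0 ble] := rn_density_lower_bound nutnu (equiv_nu SA).2
  (density_nu_inv_Loo SA).
have gpt := lower_bounded_density_intg nutnu db0 ble gpi.
pose G y := (Num.max (g y) 0 - c2 y)%R.
have Gi : intg tnu G by exact: intgB.
have mG := intg_meas Gi.
have [n nd] := small_tail Gi da0.
have fge : \forall x \ae tmu, (c1 x - n%:R <= f x)%R.
  apply: filterS3 sx (rn_densityE mutmu) ale => x px /(_ I) e ax.
  rewrite leNgt; apply/negP => fx.
  have : \int[tnu]_y (pospart f g c (x, y))%:E <
      \int[tnu]_y (pospart f g c (x, y))%:E.
    rewrite {2}px -e; apply: (@lt_le_trans _ _ da%:E); last by rewrite lee_fin.
    apply: le_lt_trans nd; apply: ge0_le_integral => //.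
    - by move=> y _; rewrite lee_fin pospart_ge0.
    - apply/measurable_EFinP.
      exact: (measurableT_comp (pospart_meas SA mf mg) (pair1_measurable x)).
    - by apply/measurable_EFinP; meas.
    - move=> y _; rewrite lee_fin /pospart /= ge_max [X in _ && X]le_max lexx
      orbT andbT.
      rewrite le_max; apply/orP; left; rewrite /G.
      have : (g y <= Num.max (g y) 0)%R by rewrite le_max lexx.
      by have := cge x y; lra.
  by rewrite ltxx.
have fgemu := null_dominates_ae mutmu fge.
apply: (ae_intg_le (g := fun x => (Num.max (f x) 0 + `|c1 x| + n%:R)%R)) => //.
  by apply: intgD; [apply: intgD => //; exact: intg_abs|exact: intg_cst].
apply: filterS fgemu => x fx.
have := ler_norm (- c1 x)%R; rewrite normrN => c1n;
  have := normr_ge0 (c1 x) => c10.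
have n0 : (0 <= n%:R :> R)%R by [].
rewrite ler_norml; apply/andP; split.
  have : (0 <= Num.max (f x) 0)%R by rewrite le_max lexx orbT.
  lra.
have : (f x <= Num.max (f x) 0)%R by rewrite le_max lexx.
lra.
Qed.

End potentials.

(** * Optimality *)

Section optimality.
Context (R : realType) d1 d2 (X : measurableType d1) (Y : measurableType d2).
Variables (mu tmu : probability X R) (nu tnu : probability Y R).
Variable c : X * Y -> R.
Hypothesis SA : standing_assumptions mu nu tmu tnu c.
Notation P := (refm tmu tnu).
Notation dual := (dual_val mu tmu nu tnu c).
Notation primal := (primal_val tmu tnu c).
Notation dual_pair := (dual_pair mu tmu nu tnu c).
Notation ZZ := (admissible mu nu tmu tnu).
Implicit Types (f : X -> R) (g : Y -> R) (Z : X * Y -> R).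

(** Square integrability of [p] comes last, from
    [p^2 = (f (+) g - c) p <= ((f - c1) (+) (g - c2)) p], whose right side is
    integrable because [p] is the density of a coupling. *)
Lemma potentials_dual_pair f g :
  measurable_fun setT f -> measurable_fun setT g ->
  potential_system mu nu tmu tnu c f g -> dual_pair f g.
Proof.
move=> mf mg sys; have SA' := standing_swap SA.
have sys' := potential_system_swap sys.
have fp := potential_funrpos_intg SA mf mg sys.
have gp := potential_funrpos_intg SA' mg mf sys'.
have fi := potential_intg SA mf mg sys gp.
have gi := potential_intg SA' mg mf sys' fp.
split=> //; have mp := pospart_meas SA mf mg.
have [pi pic pip] : coupling_density mu nu tmu tnu c f g.
  exact/(coupling_systemP SA mf mg).
have p1 : intg P (pospart f g c).
  apply: intg_lty => //; first exact: pospart_ge0.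
  by rewrite -pip// probability_setT ltry.
have [c1 [c2 [/L1P c1mu _ /L1P c2nu _ cge]]] := cost_lower_bound SA.
apply: intg_le (pairing_intg pic p1 pip (intgB fi c1mu) (intgB gi c2nu)) _.
  by meas.
move=> z; rewrite ger0_norm ?sqr_ge0//.
have p0 := pospart_ge0 c f g z; have := cge z.1 z.2;
  rewrite -surjective_pairing.
move: p0; have [->|->] := pospart_cases c f g z; last by rewrite expr0n mulr0.
by rewrite expr2 => h0 cz; apply: ler_wpM2r => //; lra.
Qed.

Lemma potentials_admissible f g :
  measurable_fun setT f -> measurable_fun setT g ->
  potential_system mu nu tmu tnu c f g -> ZZ (pospart f g c).
Proof.
move=> mf mg sys; have [_ _ p2] := potentials_dual_pair mf mg sys.
split; last exact/(coupling_systemP SA mf mg).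
by apply/L2P; split => //; exact: (pospart_meas SA mf mg).
Qed.

Lemma potentials_value f g :
  measurable_fun setT f -> measurable_fun setT g ->
  potential_system mu nu tmu tnu c f g -> dual f g = primal (pospart f g c).
Proof.
move=> mf mg sys; have [fi gi _] := potentials_dual_pair mf mg sys.
by rewrite (gap_eq SA)//; exact: potentials_admissible.
Qed.

Lemma sq_diff_intg Z Z' : ZZ Z -> ZZ Z' -> intg P (fun z =>
  (Z z - Z' z) ^+ 2)%R.
Proof.
move=> [/L2P[mZ Z2] _] [/L2P[mZ' Z'2] _].
exact: sq_intgB.
Qed.

Lemma sq_diff_ae Z Z' : ZZ Z -> ZZ Z' ->
  (\int[P]_z ((Z z - Z' z) ^+ 2) <= 0)%R -> Z = Z' %[ae P].
Proof.
move=> adm adm' le0; have H :=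
  ge0_Rint_eq0 (sq_diff_intg adm adm') (fun z => sqr_ge0 _).
have /H : (\int[P]_z ((Z z - Z' z) ^+ 2) = 0)%R.
  by apply/le_anti/andP; split=> //; apply: Rintegral_ge0 => z _;
    exact: sqr_ge0.
apply: filterS => z + _ => /(_ I) /eqP; rewrite sqrf_eq0 subr_eq0.
by move/eqP.
Qed.

Section optimum.
Variables (f : X -> R) (g : Y -> R).
Hypotheses (mf : measurable_fun setT f) (mg : measurable_fun setT g)
  (sys : potential_system mu nu tmu tnu c f g).
Notation p := (pospart f g c).

Let fg_pair : dual_pair f g. Proof. exact: potentials_dual_pair. Qed.
Let p_adm : ZZ p. Proof. exact: potentials_admissible. Qed.
Let fgp : dual f g = primal p. Proof. exact: potentials_value. Qed.

(** The source of every optimality statement: uniqueness of minimisers, the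
    variational inequality and the optimality of [(f, g)] are read off from it. *)
Lemma primal_growth Z : ZZ Z ->
  (primal p + 2^-1 * \int[P]_z ((Z z - p z) ^+ 2) <= primal Z)%R.
Proof.
by move=> adm; have [fi gi p2] := fg_pair; rewrite -fgp; exact: duality_gap.
Qed.

Lemma primal_le Z : ZZ Z -> (primal p <= primal Z)%R.
Proof.
move=> /primal_growth; apply: le_trans.
by rewrite lerDl mulr_ge0 ?invr_ge0// Rintegral_ge0// => z _; exact: sqr_ge0.
Qed.

Lemma primal_unique Z : ZZ Z -> (primal Z <= primal p)%R -> Z = p %[ae P].
Proof.
by move=> adm le; apply: sq_diff_ae => //; move: (primal_growth adm); lra.
Qed.

Lemma dual_le f' g' : dual_pair f' g' -> (dual f' g' <= dual f g)%R.
Proof.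
move=> [f'i g'i p'2]; have := duality_gap SA p_adm f'i g'i p'2.
rewrite fgp; apply: le_trans.
by rewrite lerDl mulr_ge0 ?invr_ge0// Rintegral_ge0// => z _; exact: sqr_ge0.
Qed.

Lemma primal_valueE : primal_value mu nu tmu tnu c = (primal p)%:E.
Proof.
apply/eqP; rewrite eq_le; apply/andP; split.
- apply: ereal_inf_lbound; exists p => //.
  by rewrite (primal_costE SA)//; have [] := p_adm.
- apply: le_ereal_inf_tmp => _ [Z adm <-].
  rewrite (primal_costE SA) ?lee_fin; last by have [] := adm.
  exact: primal_le.
Qed.

Lemma dual_valueE : dual_value mu nu tmu tnu c = (dual f g)%:E.
Proof.
have [fi gi p2] := fg_pair; apply/eqP; rewrite eq_le; apply/andP; split.
- apply: ge_ereal_sup => _ [[f' g'] [/= /L1P f'i /L1P g'i] <-].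
  have [->|Nyoo] := eqVneq (dual_objective mu nu tmu tnu c f' g') -oo.
    exact: leNye.
  have p'2 := dual_objective_fin SA f'i g'i Nyoo.
  by rewrite dual_objectiveE// lee_fin; exact: dual_le.
- apply: ereal_sup_ubound; exists (f, g); first by split; exact/L1P.
  by rewrite /= dual_objectiveE.
Qed.

Lemma potentials_dual_solution : dual_solution mu nu tmu tnu c f g.
Proof.
have [fi gi p2] := fg_pair; split; [exact/L1P|exact/L1P|].
by rewrite dual_valueE dual_objectiveE.
Qed.

Lemma argmin_primalP Z : argmin ZZ (primal_cost tmu tnu c) Z <->
  ZZ Z /\ Z = p %[ae P].
Proof.
split=> [[adm min]|[adm Zp]].
- split=> //; apply: primal_unique => //.
  rewrite -lee_fin -!(primal_costE SA);
    [exact: min|by case: p_adm|by case: adm].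
- split=> // Z' adm'; rewrite !(primal_costE SA); [|by case: adm'|by case: adm].
  rewrite lee_fin; apply: le_trans (primal_le adm').
  have [[/L2P[mZ _] _] [/L2P[mp _] _]] := (adm, p_adm); have mc := cost_meas SA.
  rewrite le_eqVlt; apply/orP; left; apply/eqP; congr (_ + _ * _)%R.
  + apply: ae_Rint; [by meas|by meas|].
    by apply: filterS Zp => z /(_ I) ->.
  + apply: ae_Rint; [by meas|by meas|].
    by apply: filterS Zp => z /(_ I) ->.
Qed.

Lemma sqdistE Z : ZZ Z -> sqnorm tmu tnu (EFin \o (fun z => (Z z + c z)%R)) =
  (2 * primal Z + \int[P]_z (c z ^+ 2))%:E.
Proof.
move=> [/L2P[mZ Z2] _]; have mc := cost_meas SA; have c2 := cost_sq_intg SA.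
have cZ := sq_intgM mc mZ c2 Z2.
rewrite sqnormE -EFin_Rint; last exact: sq_intgD.
congr EFin.
transitivity (\int[P]_z (2 * (c z * Z z) + Z z ^+ 2 + c z ^+ 2))%R.
  by apply: eq_Rintegral => z _; ring.
rewrite RintegralD//; last by apply: intgD => //; exact: intgZ.
rewrite RintegralD//; last exact: intgZ.
by rewrite RintegralZl// /primal_val; field.
Qed.

Lemma argmin_sqdistP Z :
  argmin ZZ (fun Z => sqnorm tmu tnu (EFin \o (fun z => (Z z + c z)%R))) Z <->
  argmin ZZ (primal_cost tmu tnu c) Z.
Proof.
have E Z1 Z2 : ZZ Z1 -> ZZ Z2 ->
    (sqnorm tmu tnu (EFin \o (fun z => (Z1 z + c z)%R)) <=
     sqnorm tmu tnu (EFin \o (fun z => (Z2 z + c z)%R))) =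
    (primal_cost tmu tnu c Z1 <= primal_cost tmu tnu c Z2).
  move=> adm1 adm2; rewrite !sqdistE// !(primal_costE SA);
    [|by case: adm2|by case: adm1].
  by rewrite !lee_fin lerD2r ler_pM2l.
split=> -[adm min]; split=> // Z' adm'.
- by rewrite -E//; exact: min.
- by rewrite E//; exact: min.
Qed.

(** The Taylor expansion of the quadratic functional [primal] at [Z]. *)
Lemma innerE Z Z' : ZZ Z -> ZZ Z' ->
  inner tmu tnu (fun z => Z z + c z)%R (fun z => Z' z - Z z)%R =
  (primal Z' - primal Z - 2^-1 * \int[P]_z ((Z' z - Z z) ^+ 2))%R.
Proof.
move=> adm adm'; have dZ2 := sq_diff_intg adm' adm.
have [[/L2P[mZ Z2] _] [/L2P[mZ' Z'2] _]] := (adm, adm').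
have mc := cost_meas SA; have c2 := cost_sq_intg SA.
have cZ := sq_intgM mc mZ c2 Z2; have cZ' := sq_intgM mc mZ' c2 Z'2.
rewrite /inner.
transitivity (\int[P]_z ((c z * Z' z + 2^-1 * Z' z ^+ 2) -
   (c z * Z z + 2^-1 * Z z ^+ 2) - 2^-1 * (Z' z - Z z) ^+ 2))%R.
  by apply: eq_Rintegral => z _; field.
have i1 : intg P (fun z => c z * Z z + 2^-1 * Z z ^+ 2)%R.
  by apply: intgD => //; exact: intgZ.
have i2 : intg P (fun z => c z * Z' z + 2^-1 * Z' z ^+ 2)%R.
  by apply: intgD => //; exact: intgZ.
rewrite RintegralB//; [|exact: intgB|exact: intgZ].
rewrite RintegralB// RintegralD//; last exact: intgZ.
rewrite RintegralD//; last exact: intgZ.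
by rewrite !RintegralZl.
Qed.

Lemma variational_inequalityP Z : ZZ Z -> Z = p %[ae P] <->
  forall Z', ZZ Z' ->
    (0 <= inner tmu tnu (fun z => Z z + c z) (fun z => Z' z - Z z))%R.
Proof.
move=> adm; split=> [Zp Z' adm'|VI].
- have [_ min] := (argmin_primalP Z).2 (conj adm Zp).
  have := min _ p_adm; rewrite !(primal_costE SA);
    [|by case: p_adm|by case: adm].
  rewrite lee_fin innerE// => Zlep.
  have := primal_growth adm'.
  have -> : (\int[P]_z ((Z' z - p z) ^+ 2) = \int[P]_z ((Z' z - Z z) ^+ 2))%R.
    have [[[/L2P[mZ _] _] [/L2P[mp _] _]] [/L2P[mZ' _] _]] :=
      (adm, p_adm, adm').
    apply: ae_Rint; [by meas|by meas|].
    by apply: filterS Zp => z /(_ I) ->.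
  by move: Zlep; lra.
- have := VI _ p_adm; rewrite innerE// => h.
  apply: sq_diff_ae => //; have := primal_growth adm.
  have e : (\int[P]_z ((p z - Z z) ^+ 2) = \int[P]_z ((Z z - p z) ^+ 2))%R.
    by apply: eq_Rintegral => z _; ring.
  by move: h; rewrite e; lra.
Qed.

End optimum.
End optimality.

(** * The regularized transport problem *)

Section regularized.
Context (R : realType) d1 d2 (X : measurableType d1) (Y : measurableType d2).
Variables (mu tmu : probability X R) (nu tnu : probability Y R).
Variable c : X * Y -> R.
Hypothesis SA : standing_assumptions mu nu tmu tnu c.
Notation P := (refm tmu tnu).
Notation primal := (primal_val tmu tnu c).
Notation ZZ := (admissible mu nu tmu tnu).
Implicit Types pi : probability (X * Y)%type R.

Lemma density_has_density pi : pi `<< P ->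
  intg P (density pi P) /\ has_density tmu tnu pi (density pi P).
Proof.
move=> piP; have mp := intg_meas (rn_density_intg piP).
have dE z : (density pi P z)%:E =
    Radon_Nikodym (charge_of_finite_measure pi) P z.
  by rewrite /density fineK// Radon_Nikodym_fin_num.
split.
  have := @Radon_Nikodym_integrable _ _ _ (charge_of_finite_measure pi) P piP.
  by apply: eq_integrable => // z _; rewrite /= dE.
move=> A mA; have := @Radon_Nikodym_integral _ _ _ (charge_of_finite_measure
  pi) P A piP mA.
rewrite /= => ->; apply: eq_integral => z _; by rewrite dE.
Qed.

Lemma sqnorm_density pi : pi `<< P ->
  sqnorm tmu tnu (Radon_Nikodym (charge_of_finite_measure pi) P) =
  \int[P]_z (density pi P z ^+ 2)%:E.
Proof.
move=> piP; rewrite -sqnormE; congr (sqnorm _ _ _); apply/funext => z /=.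
by rewrite /density fineK// Radon_Nikodym_fin_num.
Qed.

Lemma coupling_admissible pi : coupling mu nu pi -> pi `<< P ->
  intg P (fun z => density pi P z ^+ 2)%R -> ZZ (density pi P).
Proof.
move=> pic piP dsq; have [di dd] := density_has_density piP; split.
  by apply/L2P; split => //; exact: intg_meas di.
by exists pi.
Qed.

Lemma regularized_costE pi : pi `<< P ->
  intg P (fun z => density pi P z ^+ 2)%R ->
  regularized_cost tmu tnu c pi = (primal (density pi P))%:E.
Proof.
move=> piP dsq; have [di dd] := density_has_density piP.
have mc := cost_meas SA; have c2 := cost_sq_intg SA.
have cd := sq_intgM mc (intg_meas di) c2 dsq.
have ci : intg pi c by apply/(dens_intg di dd).
rewrite /regularized_cost asboolT// sqnorm_density// -!EFin_Rint//.
by rewrite -(dens_Rint di dd ci).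
Qed.

(** The lower bound [c1 (+) c2], integrable against every coupling, keeps
    [int c dpi] away from [-oo], so that an infinite norm is not compensated. *)
Lemma regularized_cost_pinfty pi : coupling mu nu pi ->
  ~ (pi `<< P /\ intg P (fun z => density pi P z ^+ 2)%R) ->
  regularized_cost tmu tnu c pi = +oo.
Proof.
move=> pic nL2; rewrite /regularized_cost; case: asboolP => // piP.
have [di dd] := density_has_density piP; have md := intg_meas di.
have mc := cost_meas SA.
have -> : sqnorm tmu tnu (Radon_Nikodym (charge_of_finite_measure pi) P) = +oo.
  rewrite sqnorm_density//; apply/eqP; rewrite eq_le leey/= leNgt.
  apply/negP => dfin; apply: nL2; split=> //.
  by apply: intg_lty => //; [meas|move=> z; exact: sqr_ge0].
rewrite gt0_muley ?lte_fin ?invr_gt0// addey//.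
have [c1 [c2 [/L1P c1mu _ /L1P c2nu _ cge]]] := cost_lower_bound SA.
have ci : intg pi (fun z => c1 z.1 + c2 z.2)%R :=
  coupling_sum_intg pic c1mu c2nu.
have aci := intg_abs ci; have maci := intg_meas aci.
rewrite integralE -ltNye; apply: (@lt_le_trans _ _
    (- \int[pi]_z (`|c1 z.1 + c2 z.2|)%:E)).
  by rewrite lteNr /= (integrable_lty measurableT aci).
rewrite -[leLHS]add0e leeB//; first exact: integral_ge0.
apply: ge0_le_integral => //.
- by apply: measurable_funeneg; exact/measurable_EFinP.
- exact/measurable_EFinP.
- move=> z _; rewrite funenegE /= maxEle; case: ifP => _; rewrite lee_fin//.
  have := cge z.1 z.2; rewrite -surjective_pairing => cz.
  have := ler_norm (- (c1 z.1 + c2 z.2))%R; rewrite normrN; lra.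
Qed.

Section optimum.
Variables (f : X -> R) (g : Y -> R).
Hypotheses (mf : measurable_fun setT f) (mg : measurable_fun setT g)
  (sys : potential_system mu nu tmu tnu c f g).
Notation p := (pospart f g c).
Variable pis : probability (X * Y)%type R.
Hypotheses (pisc : coupling mu nu pis) (pisp : has_density tmu tnu pis p).

Let p_adm : ZZ p. Proof. exact: (potentials_admissible SA). Qed.

Let p_L2 : measurable_fun setT p /\ intg P (fun z => p z ^+ 2)%R.
Proof. by have [/L2P] := p_adm. Qed.

Let p_intg : intg P p. Proof. by have [? ?] := p_L2; exact: sq_intg. Qed.

Let pisP : pis `<< P. Proof. exact: dens_dominates p_intg pisp. Qed.

Let dens_pis : density pis P = p %[ae P].
Proof.
apply: filterS2 (rn_densityE pisP) (dens_rn_density p_intg pisp) => z.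
by move=> /(_ I) <- /(_ I) <-.
Qed.

Lemma regularized_cost_opt :
  regularized_cost tmu tnu c pis = (primal p)%:E.
Proof.
have [mp p2] := p_L2; have [di _] := density_has_density pisP.
have md := intg_meas di.
have dsq : intg P (fun z => density pis P z ^+ 2)%R.
  apply: ae_intg p2; first by meas.
  by apply: filterS dens_pis => z /(_ I) ->.
have adm := coupling_admissible pisc pisP dsq.
rewrite regularized_costE// -!(primal_costE SA); [|by case: p_adm|by case: adm].
apply/eqP; rewrite eq_le; apply/andP; split.
  by have [_] := (argmin_primalP SA mf mg sys (density pis P)).2
    (conj adm dens_pis); apply.
have [_] := (argmin_primalP SA mf mg sys p).2 (conj p_adm (ae_eq_refl _ _ _)).
exact.
Qed.

Lemma regularized_argmin : argmin (coupling mu nu) (regularized_cost tmu tnu c)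
  pis.
Proof.
split=> // pi pic; rewrite regularized_cost_opt.
have [[piP dsq]|nL2] := pselect (pi `<< P /\ intg P (fun z =>
  density pi P z ^+ 2)%R).
- rewrite regularized_costE// lee_fin; apply: (primal_le SA mf mg sys).
  exact: coupling_admissible.
- by rewrite regularized_cost_pinfty// leey.
Qed.

Lemma regularized_unique pi :
  argmin (coupling mu nu) (regularized_cost tmu tnu c) pi ->
  forall A, measurable A -> pi A = pis A.
Proof.
move=> [pic min] A mA; have := min _ pisc; rewrite regularized_cost_opt.
have [[piP dsq]|nL2] := pselect (pi `<< P /\ intg P (fun z =>
  density pi P z ^+ 2)%R);
  last by rewrite regularized_cost_pinfty// leye_eq.
have adm := coupling_admissible pic piP dsq.
have [di dd] := density_has_density piP.
rewrite regularized_costE// lee_fin => /(primal_unique SA mf mg sys adm) e.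
rewrite dd// pisp//; apply: ae_eq_integral => //.
- have md := intg_meas di; exact/measurable_funTS/measurable_EFinP.
- have mp := intg_meas p_intg; exact/measurable_funTS/measurable_EFinP.
- by apply: filterS e => z /(_ I) + _ => ->.
Qed.

End optimum.
End regularized.

(** * Equivalence of the four conditions *)

Section existence_and_equivalence.
Context (R : realType) d1 d2 (X : measurableType d1) (Y : measurableType d2).
Variables (mu tmu : probability X R) (nu tnu : probability Y R).
Variable c : X * Y -> R.
Hypothesis SA : standing_assumptions mu nu tmu tnu c.
Notation P := (refm tmu tnu).

Lemma potentials_exist : exists (f : X -> R) (g : Y -> R),
  [/\ measurable_fun setT f, measurable_fun setT g
    & potential_system mu nu tmu tnu c f g].
Proof.
have [f [g [fg fgmax]]] := dual_attained SA; have [fi gi _] := fg.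
have mf := intg_meas fi; have mg := intg_meas gi.
exists f, g; split => //; apply/(coupling_systemP SA mf mg).
exact: (maximiser_coupling SA fg fgmax).
Qed.

Lemma dual_solution_system f g : measurable_fun setT f -> measurable_fun setT g
  ->
  dual_solution mu nu tmu tnu c f g -> potential_system mu nu tmu tnu c f g.
Proof.
move=> mf mg [/L1P fi /L1P gi];
  have [f0 [g0 [mf0 mg0 sys0]]] := potentials_exist.
rewrite (dual_valueE SA mf0 mg0 sys0) => opt.
have p2 : intg P (fun z => pospart f g c z ^+ 2)%R.
  by apply: (dual_objective_fin SA fi gi); rewrite opt.
move: opt; rewrite dual_objectiveE// => -[opt].
apply/(coupling_systemP SA mf mg)/(maximiser_coupling SA); first by split.
by move=> f' g' fg'; rewrite opt; exact: (dual_le SA mf0 mg0 sys0).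
Qed.

Section equivalence.
Variables (Zs : X * Y -> R).
Hypothesis Zs_opt : argmin (admissible mu nu tmu tnu) (primal_cost tmu tnu c)
  Zs.

Lemma optimal_density_coupling f g :
  measurable_fun setT f -> measurable_fun setT g ->
  optimal_density tmu tnu c Zs f g -> coupling_density mu nu tmu tnu c f g.
Proof.
move=> mf mg pZ; have [[/L2P[mZ Z2] [pi pic piZ]] _] := Zs_opt.
have mp := pospart_meas SA mf mg.
exists pi => // A mA; rewrite piZ//; apply: ae_eq_integral => //.
- exact/measurable_funTS/measurable_EFinP.
- exact/measurable_funTS/measurable_EFinP.
- by apply: filterS pZ => z /(_ I) ->.
Qed.

Lemma system_optimal_density f g :
  measurable_fun setT f -> measurable_fun setT g ->
  potential_system mu nu tmu tnu c f g -> optimal_density tmu tnu c Zs f g.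
Proof.
move=> mf mg sys; have [_ Zp] := (argmin_primalP SA mf mg sys Zs).1 Zs_opt.
exact: ae_eq_sym.
Qed.

Lemma potentials_equiv f g :
  measurable_fun setT f -> measurable_fun setT g ->
  [<-> optimal_density tmu tnu c Zs f g;
       coupling_density mu nu tmu tnu c f g;
       dual_solution mu nu tmu tnu c f g;
       potential_system mu nu tmu tnu c f g].
Proof.
move=> mf mg; tfae.
- exact: optimal_density_coupling.
- move=> /(coupling_systemP SA mf mg) sys.
  exact: potentials_dual_solution.
- exact: dual_solution_system.
- exact: system_optimal_density.
Qed.

End equivalence.
End existence_and_equivalence.

(** * The symmetric case *)

Section symmetric.
Context (R : realType) d (X : measurableType d).
Variables (mu tmu : probability X R) (c : X * X -> R).
Hypothesis SA : standing_assumptions mu mu tmu tmu c.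
Hypothesis c_sym : forall x y, c (x, y) = c (y, x).

(** Exchanging the roles of the two potentials gives again potentials, and by
    concavity their average is dual optimal. *)
Lemma symmetric_potential : exists f : X -> R,
  measurable_fun setT f /\ dual_solution mu mu tmu tmu c f f.
Proof.
have [f [g [mf mg sys]]] := potentials_exist SA.
have sys' : potential_system mu mu tmu tmu c g f.
  have := potential_system_swap sys.
  by rewrite (_ : swap_fun c = c)//; apply/funext => -[x y]; exact: c_sym.
have fg := potentials_dual_pair SA mf mg sys.
have gf := potentials_dual_pair SA mg mf sys'.
have [pairF dualF] := dual_concave SA fg gf.
have eF : (fun y => (g y + f y) / 2)%R = (fun x => (f x + g x) / 2)%R.
  by apply/funext => x; rewrite addrC.
rewrite eF in pairF dualF.
have [Fi _ F2] := pairF; have mF := intg_meas Fi.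
exists (fun x => (f x + g x) / 2)%R; split=> //; split; [exact/L1P|exact/L1P|].
rewrite (dual_valueE SA mf mg sys) dual_objectiveE//; congr EFin.
apply/le_anti/andP; split; first exact: (dual_le SA mf mg sys).
have := dual_le SA mg mf sys' fg; move: dualF; lra.
Qed.

End symmetric.

Theorem theorem2p2 (R : realType) :
  (forall (X Y : ptopologicalType)
      (mu tmu : probability (borel X) R) (nu tnu : probability (borel Y) R)
      (c : borel X * borel Y -> R),
    polish R X -> polish R Y -> standing_assumptions mu nu tmu tnu c ->
    let ZZ := admissible mu nu tmu tnu in
    let sqdist := fun Z => sqnorm tmu tnu (EFin \o (fun z => (Z z + c z)%R)) in
    (* (i) *)
    primal_value mu nu tmu tnu c = dual_value mu nu tmu tnu c /\
    exists (Zs : borel X * borel Y -> R)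
           (pis : probability (borel X * borel Y)%type R),
      (* (ii) *)
      [/\ argmin ZZ (primal_cost tmu tnu c) Zs,
          forall Z, argmin ZZ (primal_cost tmu tnu c) Z ->
            Z = Zs %[ae (refm tmu tnu)],
          argmin ZZ sqdist Zs /\
          (forall Z, argmin ZZ sqdist Z -> Z = Zs %[ae (refm tmu tnu)]),
          forall Z, ZZ Z ->
            (Z = Zs %[ae (refm tmu tnu)] <->
             forall Z', ZZ Z' ->
               (0 <= inner tmu tnu (fun z => Z z + c z) (fun z => Z' z - Z z))%R)
        & [/\ coupling mu nu pis, has_density tmu tnu pis Zs,
              argmin (coupling mu nu) (regularized_cost tmu tnu c) pis
            & forall pi, argmin (coupling mu nu) (regularized_cost tmu tnu c) pi ->
                forall A, measurable A -> pi A = pis A]] /\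
      (* (iii) *)
      (exists (f : borel X -> R) (g : borel Y -> R),
        [/\ measurable_fun setT f, measurable_fun setT g
          & [/\ optimal_density tmu tnu c Zs f g,
                coupling_density mu nu tmu tnu c f g,
                dual_solution mu nu tmu tnu c f g
              & potential_system mu nu tmu tnu c f g]]) /\
      (forall (f : borel X -> R) (g : borel Y -> R),
        measurable_fun setT f -> measurable_fun setT g ->
        [<-> optimal_density tmu tnu c Zs f g;
             coupling_density mu nu tmu tnu c f g;
             dual_solution mu nu tmu tnu c f g;
             potential_system mu nu tmu tnu c f g] /\
        ([\/ optimal_density tmu tnu c Zs f g,
             coupling_density mu nu tmu tnu c f g,
             dual_solution mu nu tmu tnu c f g
           | potential_system mu nu tmu tnu c f g] ->
         f \in Lfun mu 1 /\ g \in Lfun nu 1))) /\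
  (* (iv) *)
  (forall (X : ptopologicalType) (mu tmu : probability (borel X) R)
      (c : borel X * borel X -> R),
    polish R X -> standing_assumptions mu mu tmu tmu c ->
    (forall x y, c (x, y) = c (y, x)) ->
    (forall Zs, argmin (admissible mu mu tmu tmu) (primal_cost tmu tmu c) Zs ->
      exists f : borel X -> R, measurable_fun setT f /\
        [/\ optimal_density tmu tmu c Zs f f,
            coupling_density mu mu tmu tmu c f f,
            dual_solution mu mu tmu tmu c f f
          & potential_system mu mu tmu tmu c f f]) /\
    ereal_sup [set dual_objective mu mu tmu tmu c f f | f in
        [set f : borel X -> R | f \in Lfun mu 1]]
      = dual_value mu mu tmu tmu c).
Proof.
split.
- move=> X Y mu tmu nu tnu c _ _ SA ZZ sqdist.
  have [f [g [mf mg sys]]] := potentials_exist SA.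
  have padm : ZZ (pospart f g c) := potentials_admissible SA mf mg sys.
  have [_ [pis pisc pisp]] := padm.
  have popt : argmin ZZ (primal_cost tmu tnu c) (pospart f g c).
    by apply/(argmin_primalP SA mf mg sys); split => //; exact: ae_eq_refl.
  split.
    rewrite (primal_valueE SA mf mg sys) (dual_valueE SA mf mg sys).
    by rewrite (potentials_value SA mf mg sys).
  exists (pospart f g c), pis; split; first split=> //.
  + by move=> Z /(argmin_primalP SA mf mg sys)[].
  + split; first exact/(argmin_sqdistP SA).
    by move=> Z /(argmin_sqdistP SA)/(argmin_primalP SA mf mg sys)[].
  + by move=> Z adm; exact: (variational_inequalityP SA mf mg sys adm).
  + split=> //; first exact: (regularized_argmin SA mf mg sys pisc pisp).
    by move=> pi; exact: (regularized_unique SA mf mg sys pisc pisp).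
  split.
    exists f, g; split=> //; split; [exact: ae_eq_refl| | |by []].
    * exact/(coupling_systemP SA mf mg).
    * exact: (potentials_dual_solution SA mf mg sys).
  move=> f' g' mf' mg'; have eqv := potentials_equiv SA popt mf' mg'.
  split=> // cond.
  have sys' : potential_system mu nu tmu tnu c f' g'.
    case: cond => [/(eqv 0%N 3%N)//|/(eqv 1%N 3%N)//|/(eqv 2%N 3%N)//|//].
  have [f'i g'i _] := potentials_dual_pair SA mf' mg' sys'.
  by split; exact/L1P.
- move=> X mu tmu c _ SA c_sym.
  have [f [mf fsol]] := symmetric_potential SA c_sym.
  have [fL1 _ fval] := fsol.
  split.
    move=> Zs Zs_opt; exists f; split=> //.
    have eqv := potentials_equiv SA Zs_opt mf mf.
    split; [exact/(eqv 2%N 0%N)|exact/(eqv 2%N 1%N)|exact: fsol|exact/(eqv 2%N 3%N)].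
  apply/eqP; rewrite eq_le; apply/andP; split.
    apply: ereal_sup_le => _ [f' f'L1 <-].
    by exists (f', f').
  by rewrite -fval; apply: ereal_sup_ubound; exists f.
Qed.
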